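(* Let $X_1, X_2, \ldots$ be independent random variables with a common continuous distribution function $F$. For each $n \geq 1$ let $\Pi(n)$ be the set of feasible policies for the sequential selection of a unimodal subsequence of $X_1,\dots,X_n$, and for $\pi_n\in\Pi(n)$ let $U^o_n(\pi_n)$ be the length of the unimodal subsequence selected by $\pi_n$. Then for each $n\geq 1$ there is a policy $\pi^*_n\in \Pi(n)$ such that $$\mathbb{E}[U^o_n(\pi^*_n)] = \sup_{\pi_n\in \Pi(n)}\mathbb{E}[U^o_n(\pi_n)].$$ For such optimal policies one has, for all $n \geq 1$, the upper bound $$\mathbb{E}[U^o_n(\pi^*_n)] < 2 n^{1/2}$$ and the lower bound $$2 n^{1/2} - 4 (\pi / 6)^{1/2} n^{1/4} - O(1) < \mathbb{E}[U^o_n(\pi^*_n)]$$ (that is, there is a constant $C$ such that $2 n^{1/2} - 4 (\pi / 6)^{1/2} n^{1/4} - C < \mathbb{E}[U^o_n(\pi^*_n)]$ for all $n\ge 1$; here $\pi = 3.14159\ldots$). In particular, $$\mathbb{E}[U^o_n(\pi^*_n)] \sim 2 n^{1/2} \quad \text{as } n\rightarrow \infty.$$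
   Context: Let $\mathcal{F}_i=\sigma\{X_1,\dots,X_i\}$, $1\le i\le n$. The variables $X_1,\dots,X_n$ are presented one at a time; when $X_i$ is presented at time $i$ the chooser must irrevocably accept or reject it, using only $X_1,\dots,X_i$. A policy thus yields indices $1\le \tau_1<\tau_2<\cdots<\tau_k\le n$ of selected elements ($\tau_j$ is the index of the $j$-th selected element), each $\tau_j$ being a stopping time with respect to $(\mathcal{F}_i)$. A policy is feasible (belongs to $\Pi(n)$) if the selected values are always unimodal, meaning that for some $1\le t\le k$ $$X_{\tau_1}\le X_{\tau_2}\le\cdots\le X_{\tau_t}\ge X_{\tau_{t+1}}\ge\cdots\ge X_{\tau_k}$$ (increasing piece first, then decreasing piece; either piece may have size one). $U^o_n(\pi_n)$ is the number $k$ of elements selected by $\pi_n$. *)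

(* Defs.v *)
From mathcomp Require Import all_boot all_order all_algebra.
From mathcomp Require Import finmap.
From mathcomp Require Import all_classical all_reals all_analysis.

Set Implicit Arguments.
Unset Strict Implicit.
Unset Printing Implicit Defensive.

Import Order.TTheory GRing.Theory Num.Theory.
Import numFieldNormedType.Exports.

Local Open Scope classical_set_scope.
Local Open Scope ring_scope.

(* Times and indices start from 0: X i is the variable X_{i+1} of a sequence
   X_1, X_2, ..., and a policy for X_1, ..., X_n selects among X 0, ..., X n.-1. *)

Definition mutually_independent d (T : measurableType d) (R : realType)
    (P : probability T R) (X : nat -> {RV P >-> R}) : Prop :=
  forall (J : {fset nat}) (B : nat -> set R),
    (forall j, measurable (B j)) ->
    P (\bigcap_(j in [set` J]) X j @^-1` B j)
      = (\prod_(j <- J) P (X j @^-1` B j))%E.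

Definition has_cdf d (T : measurableType d) (R : realType)
    (P : probability T R) (X : {RV P >-> R}) (F : R -> R) : Prop :=
  forall r : R, cdf X r = (F r)%:E.

Definition natural_filtration d (T : measurableType d) (R : realType)
    (P : probability T R) (X : nat -> {RV P >-> R}) (i : nat) : set (set T) :=
  g_sigma_preimage (fun j : 'I_i.+1 => (X j : T -> R)).

(* The value None stands for "never". *)
Definition stopping_time (T : Type) (Fil : nat -> set (set T))
    (tau : T -> option nat) : Prop :=
  forall i : nat,
    Fil i [set w | exists2 m : nat, tau w = Some m & (m <= i)%N].

(* The peak, of index t, belongs to both pieces; the empty sequence is not
   unimodal since it has no peak. *)
Definition unimodal (R : realType) (s : seq R) : Prop :=
  exists2 t : nat, (t < size s)%N &
    sorted <=%O (take t.+1 s) /\ sorted >=%O (drop t s).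

(* A policy is represented by the list tau w of the indices that it selects at
   the outcome w, in order of selection; the length of this list is random. *)
Definition feasible d (T : measurableType d) (R : realType)
    (P : probability T R) (X : nat -> {RV P >-> R}) (n : nat)
    : set (T -> seq nat) :=
  [set tau | [/\ forall w, sorted ltn (tau w) /\ all (ltn^~ n) (tau w),
                 forall j, stopping_time (natural_filtration X)
                             (fun w => onth (tau w) j)
               & forall w, unimodal [seq X i w | i <- tau w]]].

Definition selected_length (R : realType) (T : Type) (tau : T -> seq nat)
    : T -> R :=
  fun w => (size (tau w))%:R.

Definition optimal d (T : measurableType d) (R : realType)
    (P : probability T R) (X : nat -> {RV P >-> R}) (n : nat)
    (tau : T -> seq nat) : Prop :=
  feasible X n tau /\
  'E_P[selected_length R tau]%E
    = ereal_sup [set 'E_P[selected_length R tau']%E | tau' in feasible X n].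

(* Main.v *)
From HB Require Import structures.
Require Import Defs.
From mathcomp Require Import all_boot all_order all_algebra.
From mathcomp Require Import finmap.
From mathcomp Require Import all_classical all_reals all_analysis.
From mathcomp Require Import measurable_realfun ring lra.

Set Implicit Arguments.
Unset Strict Implicit.
Unset Printing Implicit Defensive.

Import Order.TTheory GRing.Theory Num.Theory.
Import numFieldNormedType.Exports.

Local Open Scope classical_set_scope.
Local Open Scope ring_scope.

(** The variables F(X_i) are independent and uniform on [0, 1], and the state of
    a selection is a single number, its room (see [step]). Dynamic programming
    gives the optimal expectation as [value n 3]: along any policy the number of
    selections plus the value of the room is a supermartingale, and a martingale
    for the policy that selects when this does not decrease the value, which may
    ignore ties because they are null.
    Upper bound: by induction, [value n] lies below the line of slope [l] with
    intercept [n / (2 * l)], and [l = sqrt n / 2] is the best slope.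
    Lower bound: spend half of the time on an increasing and half on a decreasing
    subsequence, each time selecting inside a window of fixed width; an explicit
    quadratic minorant of the value bounds the loss caused by fluctuations. *)

(** The state of a selection is a last value together with a phase. Reflecting the increasing phase
    to [2 - x] glues the two phases end to end, and turning becomes one large jump downwards.
    Selecting the same value from a larger room leaves at least as much room, so the value is a
    nondecreasing function of one real number; this gives its measurability. Both bounds then look
    like those for a monotone subsequence with room 2: there the line of slope [l] has height
    [2 * l + n / (2 * l)], whose minimum is [2 * sqrt n]. Ties prevent treating all policies by one
    rule. A feasible policy may select equal values and [F] may merge different ones, so bounding
    every policy takes weak comparisons; but equal values of [F] do not order the variables, so the
    constructed policy compares strictly. The loss in the lower bound has leading term
    [7 / 6 * n ^ (1 / 4)], and [7 / 6] is below [4 * sqrt (pi / 6)] already because [pi >= 2]. *)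

Section integrals_of_quadratic_pieces.
Context {R : realType}.
Notation mu := (@lebesgue_measure R).
Implicit Types (f g : R -> R) (a b c k al be ga u : R).

Lemma integrable01 f k : measurable_fun setT f ->
  (forall u, 0 <= u <= 1 -> `|f u| <= k) ->
  mu.-integrable `[0, 1] (EFin \o f).
Proof.
move=> mf fk; apply: measurable_bounded_integrable => //.
- by rewrite /= lebesgue_measure_itv/= lte_fin ltr01 -EFinB ltry.
- exact: measurable_funTS.
- exists k; split; first exact: num_real.
  move=> x kx u /=; rewrite in_itv/= => u01.
  exact: le_trans (fk _ u01) (ltW kx).
Qed.

Lemma integrable01D f g : mu.-integrable `[0, 1] (EFin \o f) ->
  mu.-integrable `[0, 1] (EFin \o g) ->
  mu.-integrable `[0, 1] (EFin \o (fun u => f u + g u)).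
Proof.
move=> mf mg; rewrite (_ : _ \o _ = (EFin \o f) \+ (EFin \o g))%E; last first.
  by apply/funext => u /=; rewrite EFinD.
exact: integrableD.
Qed.

(** The functions to integrate are polynomials in the room spent by selecting [u], or in a bound for
    it, which is [u - c] or [c - u] for a suitable [c]; hence the centred form. *)
Definition quad al be ga c u := al + be * (u - c) + ga * (u - c) ^+ 2.

Definition quad_prim al be ga c u :=
  al * u + be / 2 * (u - c) ^+ 2 + ga / 3 * (u - c) ^+ 3.

Definition piece a b al be ga c u :=
  if a <= u <= b then quad al be ga c u else 0.

Lemma measurable_piece a b al be ga c :
  measurable_fun setT (piece a b al be ga c).
Proof.
apply: measurable_fun_ifT.
- by apply: measurable_and; exact: measurable_fun_ler.
- by apply: measurable_funD; [apply: measurable_funD => //|];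
    apply: measurable_funM => //; (apply: measurable_funX || idtac);
    exact: measurable_funB.
- exact: measurable_cst.
Qed.

Lemma integrable_piece a b al be ga c :
  mu.-integrable `[0, 1] (EFin \o piece a b al be ga c).
Proof.
apply: (@integrable01 _ (`|al| + `|be| * (1 + `|c|) + `|ga| * (1 + `|c|) ^+ 2)).
  exact: measurable_piece.
move=> u /andP[u0 u1]; rewrite /piece /quad.
have B0 : 0 <= `|al| + `|be| * (1 + `|c|) + `|ga| * (1 + `|c|) ^+ 2.
  by apply: addr_ge0; [apply: addr_ge0 => //; apply: mulr_ge0 => //; apply: addr_ge0
                     |apply: mulr_ge0 => //; apply: exprn_ge0; apply: addr_ge0].
case: ifP => _; last by rewrite normr0.
have uc : `|u - c| <= 1 + `|c|.
  by rewrite (le_trans (ler_normB _ _))// lerD2r ger0_norm.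
rewrite (le_trans (ler_normD _ _))// lerD//.
  rewrite (le_trans (ler_normD _ _))// lerD2l normrM.
  by rewrite ler_wpM2l.
by rewrite normrM ler_wpM2l// normrX lerXn2r// ?nnegrE ?addr_ge0.
Qed.

Lemma Rintegral_piece a b al be ga c : 0 <= a -> a <= b -> b <= 1 ->
  \int[mu]_(u in `[0, 1]) piece a b al be ga c u =
  quad_prim al be ga c b - quad_prim al be ga c a.
Proof.
move=> a0 ab b1.
pose Q : {poly R} := al *: 'X + (be / 2) *: ('X - c%:P) ^+ 2
                     + (ga / 3) *: ('X - c%:P) ^+ 3.
have QE u : Q.[u] = quad_prim al be ga c u by rewrite /Q /quad_prim !hornerE; ring.
have Q'E u : (Q^`()).[u] = quad al be ga c u.
  rewrite /Q !poly.derivE !hornerE /quad.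
  rewrite /=.
  by field.
have -> : piece a b al be ga c = (horner Q^`()) \_ `[a, b].
  apply/funext => u; rewrite /piece patchE -Q'E.
  by rewrite [u \in _]asboolb in_itv.
rewrite -Rintegral_mkcondr.
rewrite (_ : _ `&` _ = `[a, b]%classic); last first.
  apply/seteqP; split => u /=; rewrite !in_itv/=; first by case.
  by move=> /andP[h1 h2]; split; lra.
rewrite -!QE.
have [<-|neq] := eqVneq a b.
  by rewrite set_itv1 Rintegral_set1 subrr.
have lab : a < b by rewrite lt_neqAle neq.
rewrite /Rintegral (@continuous_FTC2 _ _ (horner Q)) //.
- by apply/continuous_subspaceT => u; exact: continuous_horner.
- split.
  + by move=> u _; exact: derivable_horner.
  + by apply: cvg_at_right_filter; exact: continuous_horner.
  + by apply: cvg_at_left_filter; exact: continuous_horner.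
- by move=> u _; rewrite -derivE.
Qed.

Lemma Rintegral_cst01 k : \int[mu]_(u in `[0, 1]) k = k.
Proof.
rewrite Rintegral_cst//= lebesgue_measure_itv/= lte_fin ltr01 -EFinB/= subr0.
by rewrite mulr1.
Qed.

Lemma integrable_cst01 k : mu.-integrable `[0, 1] (EFin \o (fun=> k)).
Proof. by apply: (@integrable01 _ `|k|) => //; exact: measurable_cst. Qed.

Lemma Rintegral_ge_piece g k a b al be ga c : 0 <= a -> a <= b -> b <= 1 ->
  mu.-integrable `[0, 1] (EFin \o g) ->
  (forall u, 0 <= u <= 1 -> k + piece a b al be ga c u <= g u) ->
  k + (quad_prim al be ga c b - quad_prim al be ga c a)
    <= \int[mu]_(u in `[0, 1]) g u.
Proof.
move=> a0 ab b1 ig gk.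
have i1 := integrable_cst01 k.
have i2 := integrable_piece a b al be ga c.
rewrite -Rintegral_piece// -[X in X + _]Rintegral_cst01 -RintegralD//.
apply: le_Rintegral => //; first exact: integrable01D.
Qed.

Lemma Rintegral_le_piece2 g k a b al be ga c a' b' al' be' ga' c' :
  0 <= a -> a <= b -> b <= 1 -> 0 <= a' -> a' <= b' -> b' <= 1 ->
  mu.-integrable `[0, 1] (EFin \o g) ->
  (forall u, 0 <= u <= 1 ->
    g u <= k + piece a b al be ga c u + piece a' b' al' be' ga' c' u) ->
  \int[mu]_(u in `[0, 1]) g u <=
  k + (quad_prim al be ga c b - quad_prim al be ga c a) +
      (quad_prim al' be' ga' c' b' - quad_prim al' be' ga' c' a').
Proof.
move=> a0 ab b1 a'0 ab' b'1 ig gk.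
have i0 := integrable_cst01 k.
have i1 := integrable_piece a b al be ga c.
have i2 := integrable_piece a' b' al' be' ga' c'.
have i01 := integrable01D i0 i1.
rewrite -!Rintegral_piece// -[X in X + _ + _]Rintegral_cst01 -RintegralD//.
rewrite -RintegralD//.
apply: le_Rintegral => //; first exact: integrable01D.
Qed.

End integrals_of_quadratic_pieces.

(** * Dynamic programming: the value of a room *)

Section value_function.
Context {R : realType}.
Notation mu := (@lebesgue_measure R).
Implicit Types (f : R -> R) (rho u : R) (k : nat).

(* Values are uniform on [0, 1] here. The room [rho] encodes both the last
   selected value [x] and the phase: [rho = 2 - x] while the increasing piece
   can still be extended, and [rho = x] once the sequence has turned; a room
   above 2 means that nothing is selected yet. *)
Definition step rho u := if 2 - u <= rho then 2 - u else u.

Definition selectable rho u := (2 - u <= rho) || (u <= rho).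

(* Without ties, unimodality of the values of [F] gives that of the variables,
   although [F] need not be injective. *)
Definition strictly_selectable rho u :=
  (2 - u < rho) || (u < Num.min rho (2 - rho)).

Definition gain_on (b : bool) f rho u :=
  if b then Num.max (f rho) (1 + f (step rho u)) else f rho.

Definition gain f rho u := gain_on (selectable rho u) f rho u.

Definition strict_gain f rho u := gain_on (strictly_selectable rho u) f rho u.

Fixpoint value k rho : R :=
  if k is k'.+1 then \int[mu]_(u in `[0, 1]) gain (value k') rho u else 0.

Section measurability.
Context d (T : measurableType d) (r v : T -> R).
Hypotheses (mr : measurable_fun setT r) (mv : measurable_fun setT v).

Lemma measurable_step : measurable_fun setT (fun x => step (r x) (v x)).
Proof.
have m2 : measurable_fun setT (fun x => 2 - v x) by exact: measurable_funB.
by apply: measurable_fun_ifT => //; exact: measurable_fun_ler.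
Qed.

Lemma measurable_selectable :
  measurable_fun setT (fun x => selectable (r x) (v x)).
Proof.
have m2 : measurable_fun setT (fun x => 2 - v x) by exact: measurable_funB.
by apply: measurable_or; exact: measurable_fun_ler.
Qed.

Lemma measurable_strictly_selectable :
  measurable_fun setT (fun x => strictly_selectable (r x) (v x)).
Proof.
have m2 : measurable_fun setT (fun x => 2 - v x) by exact: measurable_funB.
have m2' : measurable_fun setT (fun x => 2 - r x) by exact: measurable_funB.
apply: measurable_or; apply: measurable_fun_ltr => //.
exact: measurable_minr.
Qed.

Lemma measurable_gain_on (b : T -> bool) f : measurable_fun setT b ->
  nondecreasing_fun f -> measurable_fun setT (fun x => gain_on (b x) f (r x) (v x)).
Proof.
move=> mb ndf; have mf : measurable_fun setT f by exact: nondecreasing_measurable.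
have mfr : measurable_fun setT (fun x => f (r x)) by exact: measurableT_comp.
apply: measurable_fun_ifT => //.
apply: measurable_maxr => //; apply: measurable_funD => //.
by apply: measurableT_comp => //; exact: measurable_step.
Qed.

Lemma measurable_gain f : nondecreasing_fun f ->
  measurable_fun setT (fun x => gain f (r x) (v x)).
Proof. by move=> ndf; apply: measurable_gain_on => //; exact: measurable_selectable. Qed.

Lemma measurable_strict_gain f : nondecreasing_fun f ->
  measurable_fun setT (fun x => strict_gain f (r x) (v x)).
Proof.
by move=> ndf; apply: measurable_gain_on => //; exact: measurable_strictly_selectable.
Qed.

End measurability.

Lemma gain_on_ge b f rho u : f rho <= gain_on b f rho u.
Proof. by rewrite /gain_on; case: b => //; rewrite le_max lexx. Qed.

Lemma gain_on_le b f rho u k : (forall x, f x <= k%:R) ->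
  gain_on b f rho u <= k.+1%:R.
Proof.
move=> fk; have := fk rho; have := fk (step rho u).
rewrite /gain_on -natr1; case: b => h1 h2; last by lra.
by rewrite ge_max; apply/andP; split; lra.
Qed.

(** A selectable [u] stays selectable when the room grows, and the step does not get worse: if the
    larger room lets [u] extend the increasing piece, the new room is [2 - u], which is at least [u]
    since [u <= 1]. *)
Lemma gain_le f rho rho' u : nondecreasing_fun f -> u <= 1 -> rho <= rho' ->
  gain f rho u <= gain f rho' u.
Proof.
move=> ndf u1 rr'.
have frr' := ndf _ _ rr'.
rewrite {1}/gain /gain_on; case: ifPn => [sel|_]; last first.
  by apply: le_trans frr' _; exact: gain_on_ge.
rewrite /gain /gain_on ifT; last first.
  by move: sel; rewrite /selectable => /orP[] h; apply/orP; [left|right]; lra.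
rewrite ge_max !le_max frr'/=; apply/orP; right; rewrite lerD2l; apply: ndf.
by rewrite /step; case: ifPn; case: ifPn => h1 h2; lra.
Qed.

Lemma integrable_gain f rho k : nondecreasing_fun f ->
  (forall x, 0 <= f x <= k%:R) -> mu.-integrable `[0, 1] (EFin \o gain f rho).
Proof.
move=> ndf fk; apply: (@integrable01 _ _ k.+1%:R).
  by apply: (@measurable_gain _ _ (fun=> rho) id).
move=> u _; have /andP[f0 _] := fk rho.
rewrite ger0_norm; last by apply: le_trans f0 _; exact: gain_on_ge.
by apply: gain_on_le => x; have /andP[] := fk x.
Qed.

(** One induction proves monotonicity and bounds together, because integrability of the gain, used
    for each of them, rests on both. *)
Lemma value_spec k :
  nondecreasing_fun (value k) /\ forall rho, 0 <= value k rho <= k%:R.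
Proof.
elim: k => [|k [ndv vk]]; first by split => [x y _|x] //=; rewrite lexx.
have ig rho := integrable_gain rho ndv vk.
split => [rho rho' rr'|rho] /=.
  apply: le_Rintegral => // u; rewrite /= in_itv/= => /andP[u0 u1].
  exact: gain_le.
rewrite Rintegral_ge0/=; last first.
  by move=> u _; have /andP[v0 _] := vk rho; apply: le_trans v0 _; exact: gain_on_ge.
rewrite -[leRHS]Rintegral_cst01; apply: le_Rintegral => //.
  exact: integrable_cst01.
by move=> u _; apply: gain_on_le => x; have /andP[] := vk x.
Qed.

Lemma value_nd k : nondecreasing_fun (value k).
Proof. by case: (value_spec k). Qed.

Lemma value_ge0 k rho : 0 <= value k rho.
Proof. by case: (value_spec k) => _ /(_ rho)/andP[]. Qed.

Lemma value_le k rho : value k rho <= k%:R.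
Proof. by case: (value_spec k) => _ /(_ rho)/andP[]. Qed.

Lemma integrable_gain_value k rho :
  mu.-integrable `[0, 1] (EFin \o gain (value k) rho).
Proof. by case: (value_spec k) => ndv vk; exact: integrable_gain vk. Qed.

Lemma value_leS k rho : value k rho <= value k.+1 rho.
Proof.
rewrite /= -[leLHS]Rintegral_cst01; apply: le_Rintegral => //.
- exact: integrable_cst01.
- exact: integrable_gain_value.
- by move=> u _; exact: gain_on_ge.
Qed.

Lemma strict_gainE f rho u : u != rho -> u != 2 - rho -> 0 <= u <= 1 ->
  strict_gain f rho u = gain f rho u.
Proof.
move=> n1 n2 /andP[u0 u1]; congr gain_on; apply/idP/idP.
  by move=> /orP[h|]; [|rewrite lt_min => /andP[h1 h2]]; apply/orP; [left|right]; lra.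
move=> /orP[h|h]; apply/orP.
  by left; rewrite lt_neqAle h andbT; apply: contra n2 => /eqP <-; apply/eqP; ring.
have h' : u < rho by rewrite lt_neqAle h n1.
have [h2|h2] := ltP (2 - u) rho; [by left|right].
rewrite lt_min h'/= lt_neqAle n2/=; lra.
Qed.

(** The two gains can differ only at [u = rho] and [u = 2 - rho], the ties with the last selected
    value in either phase; these two points form a null set. *)
Lemma value_strict_gain k rho :
  (\int[mu]_(u in `[0%R, 1%R]) (strict_gain (value k) rho u)%:E)%E =
  (value k.+1 rho)%:E.
Proof.
rewrite /= fineK; last exact: integrable_fin_num (integrable_gain_value k rho).
have nd := value_nd k.
apply: ae_eq_integral => //.
- apply/measurable_EFinP; apply: measurable_funTS.
  exact: (@measurable_strict_gain _ _ (fun=> rho) id).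
- apply/measurable_EFinP; apply: measurable_funTS.
  exact: (@measurable_gain _ _ (fun=> rho) id).
exists ([set rho] `|` [set 2 - rho]); split.
- exact: measurableU.
- apply/eqP; rewrite -measure_le0; apply: le_trans (measureU2 _ _ _) _ => //.
  have m0 (x : R) : mu [set x] = 0%E by exact: lebesgue_measure_set1.
  have : (mu [set rho] + mu [set (2 - rho)%R] <= 0)%E.
    by rewrite (m0 rho) (m0 (2 - rho)) adde0.
  exact.
- move=> u /=; apply: contra_notP => /not_orP[n1 n2].
  by rewrite in_itv/= => u01; rewrite strict_gainE//; apply/eqP.
Qed.

End value_function.

(** * One-step upper bound for the expected gain *)

Section gain_integral.
Context {R : realType}.
Notation mu := (@lebesgue_measure R).
Implicit Types (f : R -> R) (rho u l c : R) (k : nat).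

(** Room 2 already lets every value of [0, 1] start the increasing piece. The initial room is 3 so
    that the strict rule, too, accepts every first value, even 0. *)
Lemma value_ge2 k rho : 2 <= rho -> value k rho = value k 2.
Proof.
elim: k rho => // k IH rho r2 /=; apply: eq_Rintegral => u.
rewrite inE/= in_itv/= => /andP[u0 u1].
rewrite /gain /gain_on /selectable /step.
have -> : (2 - u <= rho) by lra.
have -> : (2 - u <= 2) by lra.
by rewrite IH.
Qed.

Lemma piece_ge0 (a b al be ga c u : R) :
  (a <= u <= b -> 0 <= quad al be ga c u) -> 0 <= piece a b al be ga c u.
Proof. by rewrite /piece; case: ifP => // h; exact. Qed.

Lemma piece0 (a b c u : R) : piece a b 0 0 0 c u = 0.
Proof. by rewrite /piece /quad !mul0r !addr0 if_same. Qed.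

(* The room spent by a selection is [s = rho - step rho u]; over all [u] it
   covers each point of [0, rho] at most once, so that the expected increment
   is at most the integral of [Num.max 0 (1 - l * s)], which is [1 / (2 * l)]. *)
Lemma Rintegral_gain_le f l c rho : 0 < l -> 0 <= rho <= 2 ->
  (forall x, 0 <= x <= 2 -> f x <= l * x + c) ->
  mu.-integrable `[0, 1] (EFin \o gain f rho) ->
  \int[mu]_(u in `[0, 1]) gain f rho u <= l * rho + c + (2 * l)^-1.
Proof.
move=> l0 /andP[r0 r2] fle ig.
have [il lil] : exists il, il = l^-1 by exists l^-1.
have il0 : 0 < il by rewrite lil invr_gt0.
have lK : l * il = 1 by rewrite lil divff// gt_eqF.
have -> : (2 * l)^-1 = il / 2 by rewrite lil invfM mulrC.
(* It suffices to dominate the increment [1 - l * s] of a selection by some [p]; nonnegativity of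
   [p] covers rejections. *)
have gainle p : (forall u, 0 <= u <= 1 -> 0 <= p u) ->
    (forall u, 0 <= u <= 1 -> selectable rho u ->
      1 + l * step rho u <= l * rho + p u) ->
    forall u, 0 <= u <= 1 -> gain f rho u <= l * rho + c + p u.
  move=> p0 hp u u01; have pu := p0 u u01; have fr := fle rho.
  rewrite r0 r2 in fr; have {}fr := fr isT.
  rewrite /gain /gain_on; case: ifPn => [sel|_]; last by lra.
  rewrite ge_max; apply/andP; split; first by lra.
  have := hp u u01 sel; have /andP[u0 u1] := u01.
  have := fle (step rho u); rewrite (_ : 0 <= step rho u <= 2); last first.
    by rewrite /step; case: ifP => _; apply/andP; split; lra.
  by move=> /(_ isT); lra.
(* After the turn a selection spends [rho - u], and [1 - l * s] is positive only for [u] above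
   [rho - il], truncated at 0. *)
have [r1|r1] := leP rho 1.
  pose a := Num.max 0 (rho - il).
  have [a0 ai] : 0 <= a /\ rho - il <= a by rewrite /a !le_max !lexx orbT.
  have ar : a <= rho by rewrite /a ge_max r0/=; lra.
  have la : l * (rho - il) <= l * a by rewrite ler_wpM2l// ltW.
  apply: (le_trans (@Rintegral_le_piece2 _ _ (l * rho + c) a rho 1 l 0 rho 0 0 0 0 0 0
    _ _ _ _ _ _ _ _)) => //.
    move=> u u01; rewrite piece0 addr0; move: u u01; apply: gainle.
      move=> u u01; apply: piece_ge0 => /andP[au ur].
      rewrite /quad.
      have : l * a <= l * u by rewrite ler_wpM2l// ltW.
      by lra.
    move=> u /andP[u0 u1] sel.
    have [ur su] : u <= rho /\ step rho u = u.
      by move: sel; rewrite /selectable /step; case: ifP => [h _|_ /= h]; split; lra.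
    rewrite su /piece ur andbT; case: (leP a u) => au; first by rewrite /quad; lra.
    have ari : a = rho - il.
      by move: au; rewrite /a; case: (leP 0 (rho - il)) => ? ?; lra.
    have : l * u <= l * a by rewrite ler_wpM2l// ltW.
    rewrite ari; lra.
  rewrite /quad_prim.
  have : 0 <= (1 - l * (rho - a)) ^+ 2 * il by rewrite mulr_ge0 ?sqr_ge0// ltW.
  have -> : (1 - l * (rho - a)) ^+ 2 * il = il - 2 * (rho - a) * (l * il)
     + l * (rho - a) ^+ 2 * (l * il) by ring.
  by rewrite lK; lra.
(* Increasing phase with last value [1 - t]: going up spends [u - (1 - t)], at most [t], whereas
   turning spends [rho - u], at least [2 * t]. If [il <= t], turning never pays and one piece
   suffices. *)
pose t := rho - 1.
have tE : t = rho - 1 by [].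
have [lt|tl] := leP il t.
  have lrt : l * (1 - t) + l * t = l by ring.
  apply: (le_trans (@Rintegral_le_piece2 _ _ (l * rho + c) (1 - t) (1 - t + il) 1 (- l) 0 (1 - t)
     0 0 0 0 0 0 _ _ _ _ _ _ _ _)) => //; try lra.
    move=> u u01; rewrite piece0 addr0; move: u u01; apply: gainle.
      move=> u u01; apply: piece_ge0 => /andP[au ur].
      rewrite /quad.
      have : l * u <= l * (1 - t + il) by rewrite ler_wpM2l// ltW.
      by lra.
    move=> u /andP[u0 u1] sel.
    rewrite /piece /step.
    have [h|h] := leP (2 - u) rho.
      have -> : 1 - t <= u by lra.
      rewrite /quad/=; case: (leP u (1 - t + il)) => hu; first by rewrite tE; lra.
      have : l * (1 - t + il) <= l * u by rewrite ler_wpM2l// ltW.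
      by rewrite tE; lra.
    rewrite ifF; last by apply/negbTE; rewrite negb_and -!ltNge; apply/orP; left; lra.
    have : l * u <= l * (1 - t) by rewrite ler_wpM2l//; lra.
    have : l * il <= l * t by rewrite ler_wpM2l//; lra.
    by rewrite tE; lra.
  rewrite /quad_prim subrr !expr0n/= !mulr0 !mul0r !addr0.
  rewrite (_ : 1 - t + il - (1 - t) = il); last by ring.
  rewrite (_ : - l / 2 * il ^+ 2 = - (l * il) * il / 2); last by field.
  by rewrite lK; lra.
(* Now turning may pay. Charging it [1 - u] instead of [t + (1 - u)] is generous, but places the
   second piece right after the first: together they integrate [1 - l * s] over [s] in [0, m]. *)
pose m := Num.min 1 il.
have [m1 mi] : m <= 1 /\ m <= il by rewrite /m !ge_min !lexx orbT.
have tm : t <= m by rewrite /m le_min; apply/andP; split; lra.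
apply: (le_trans (@Rintegral_le_piece2 _ _ (l * rho + c) (1 - t) 1 1 (- l) 0 (1 - t)
     (1 - m) (1 - t) 1 l 0 1 _ _ _ _ _ _ _ _)) => //; try lra.
  have p1 u : 0 <= u <= 1 -> 0 <= piece (1 - t) 1 1 (- l) 0 (1 - t) u.
    move=> /andP[u0 u1]; apply: piece_ge0 => /andP[au ur]; rewrite /quad.
    have : l * (u - (1 - t)) <= l * il by rewrite ler_wpM2l//; lra.
    by lra.
  have p2 u : 0 <= u <= 1 -> 0 <= piece (1 - m) (1 - t) 1 l 0 1 u.
    move=> /andP[u0 u1]; apply: piece_ge0 => /andP[au ur]; rewrite /quad.
    have : l * (1 - u) <= l * il by rewrite ler_wpM2l//; lra.
    by lra.
  move=> u u01; rewrite -addrA; move: u u01; apply: gainle.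
    by move=> u u01; rewrite addr_ge0 ?p1 ?p2.
  move=> u u01 sel; have := p1 u u01; have := p2 u u01; case/andP: u01 => u0 u1.
  rewrite /step; have [h|h] := leP (2 - u) rho.
    have h1 : 1 - t <= u by lra.
    by move=> h2 _; rewrite [X in _ + (X + _)]/piece h1 u1 /quad/= tE; lra.
  have h1 : u <= 1 - t by lra.
  have lr : l * rho = l + l * t by rewrite tE; ring.
  have lt0 : 0 <= l * t by rewrite mulr_ge0//; lra.
  move=> _ h2; rewrite [X in _ + (_ + X)]/piece h1 andbT.
  have [mu1|mu1] := leP (1 - m) u; first by rewrite /quad; lra.
  have mE : m = il by move: mu1; rewrite /m; case: (leP 1 il) => ? ?; lra.
  have : l * u <= l * (1 - il) by rewrite ler_wpM2l//; lra.
  by lra.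
rewrite /quad_prim !subrr !expr0n/= !mulr0 !mul0r !addr0.
have : 0 <= (1 - l * m) ^+ 2 * il by rewrite mulr_ge0 ?sqr_ge0// ltW.
have -> : (1 - l * m) ^+ 2 * il = il - 2 * m * (l * il)
   + l * m ^+ 2 * (l * il) by ring.
by rewrite lK; lra.
Qed.

End gain_integral.

(** * The upper bound on the value *)

Section value_upper_bound.
Context {R : realType}.
Notation mu := (@lebesgue_measure R).
Implicit Types (rho u l : R) (n : nat).

(** The subtracted minimum is the slack with a single variable: the value is then at most the
    minimum of [rho] and 1, which comes closest to the line at [rho = 0] or [rho = 1]. The induction
    carries this slack along unchanged, and it makes the final bound strict. *)
Lemma value_upper l rho n : 0 < l -> 0 <= rho <= 2 ->
  value n.+1 rho <= l * rho + n.+1%:R / (2 * l)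
    - Num.min (2 * l)^-1 (l + (2 * l)^-1 - 1).
Proof.
move=> l0; set e := Num.min _ _.
have il0 : 0 < (2 * l)^-1 by rewrite invr_gt0; lra.
have [e1 e2] : e <= (2 * l)^-1 /\ e <= l + (2 * l)^-1 - 1.
  by rewrite /e !ge_min !lexx orbT.
elim: n rho => [|n IH] rho /andP[r0 r2].
  rewrite mul1r.
  have [r1|r1] := leP rho 1; last first.
    have := value_le 1 rho; have : l * 1 <= l * rho by rewrite ler_wpM2l; lra.
    by lra.
  have : value 1 rho <= rho.
    rewrite -[leRHS]add0r.
    have -> : 0 + rho = 0 + (quad_prim 1 0 0 0 rho - quad_prim 1 0 0 0 0)
      + (quad_prim 0 0 0 0 0 - quad_prim 0 0 0 0 0) :> R by rewrite /quad_prim; lra.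
    have ig := integrable_gain_value 0 rho.
    apply: Rintegral_le_piece2 => // u /andP[u0 u1]; rewrite piece0 addr0 add0r /gain /gain_on.
    have -> : selectable rho u = (0 <= u <= rho).
      rewrite u0/= /selectable; case: (leP u rho) => h; first by rewrite orbT.
      by rewrite orbF; apply/negbTE; rewrite -ltNge; lra.
    rewrite /piece /quad; case: ifP => // _.
    by rewrite ge_max /=; apply/andP; split; lra.
  have : (l - 1) * rho + (2 * l)^-1 - e >= 0.
    have [l1|l1] := leP 1 l.
      have : 0 <= (l - 1) * rho by rewrite mulr_ge0; lra.
      by lra.
    have : 0 <= (1 - l) * (1 - rho) by rewrite mulr_ge0; lra.
    by lra.
  by lra.
have fle x : 0 <= x <= 2 -> value n.+1 x <= l * x + (n.+1%:R / (2 * l) - e).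
  by move=> /IH; rewrite addrA.
have r02 : 0 <= rho <= 2 by rewrite r0.
have := Rintegral_gain_le l0 r02 fle (integrable_gain_value n.+1 rho).
rewrite -[\int[mu]_(u in _) _]/(value n.+2 rho) -(natr1 n.+1).
by lra.
Qed.

Lemma value_upper_sqrt n : (1 <= n)%N -> value n 3 < 2 * Num.sqrt n%:R :> R.
Proof.
case: n => // n _; rewrite value_ge2; last by lra.
set s := Num.sqrt _.
have s1 : 1 <= s by rewrite -[leLHS]sqrtr1 ler_sqrt// ler1n.
have ss : s ^+ 2 = n.+1%:R by rewrite sqr_sqrtr.
have l0 : 0 < s / 2 by lra.
have := @value_upper (s / 2) 2 n l0; rewrite lexx ler0n => /(_ isT).
have -> : 2 * (s / 2) = s by field.
rewrite -ss (_ : s ^+ 2 / s = s); last by field; lra.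
set e := Num.min _ _; suff : 0 < e by lra.
rewrite /e lt_min invr_gt0; apply/andP; split; first by lra.
have : 0 < (s ^+ 2 / 2 + 1 - s) / s.
  rewrite divr_gt0//; last by lra.
  have : 0 <= (s - 1) ^+ 2 by exact: sqr_ge0.
  by lra.
have -> // : (s ^+ 2 / 2 + 1 - s) / s = s / 2 + s^-1 - 1.
by field; lra.
Qed.

End value_upper_bound.

(** * Quadratic minorants of the value *)

Section value_lower_bound.
Context {R : realType}.
Notation mu := (@lebesgue_measure R).
Implicit Types (rho u d a q : R) (k m n : nat).

(* A policy that selects in a window of width [d] whenever it has room [d]
   spends in each of the [k] remaining steps the expected room [d ^+ 2 / 2],
   so that [z] is the expected room that it lacks; the quadratic penalty in [z]
   bounds the loss due to running out of room, and its increments absorb the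
   variance of the room spent. *)
Definition value_minorant d a k rho :=
  let z := k%:R * d ^+ 2 / 2 - rho in
  let q := (2 * a * d)^-1 in
  k%:R * d - q * (z + a) ^+ 2 - k%:R * d ^+ 3 * q / 3 - 2.

Variables d a : R.
Hypotheses (d0 : 0 < d) (a0 : 0 < a).

Let q := (2 * a * d)^-1.

Let q0 : 0 < q. Proof. by rewrite invr_gt0 !mulr_gt0. Qed.

Let qK : 2 * a * d * q = 1.
Proof. by rewrite divff// gt_eqF// !mulr_gt0. Qed.

(** Where the window does not fit, the minorant claims nothing, so running out of room needs no
    separate analysis. The choice of [q] makes the parabola [q * (z + a) ^+ 2] tangent at [z = a] to
    the line [2 * z / d], that is [k * d - 2 * rho / d]; the constant 2 in the minorant pays for
    [2 * rho / d]. *)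
Lemma value_minorant_le0 k rho : rho <= d -> value_minorant d a k rho <= 0.
Proof.
move=> rd; rewrite /value_minorant -/q; set z := _ - rho.
rewrite -(pmulr_rle0 _ d0).
have h1 : 0 <= q * d * (z - a) ^+ 2 by rewrite mulr_ge0 ?sqr_ge0// mulr_ge0// ltW.
have h2 : q * d * (z - a) ^+ 2 = d * q * (z + a) ^+ 2 - 2 * z * (2 * a * d * q).
  by ring.
have h3 : 0 <= d * (k%:R * d ^+ 3 * q / 3).
  by rewrite !mulr_ge0// ?exprn_ge0//; exact: ltW.
rewrite qK in h2.
have h4 : 2 * z = d * (k%:R * d) - 2 * rho by rewrite /z; field.
have -> : d * (k%:R * d - q * (z + a) ^+ 2 - k%:R * d ^+ 3 * q / 3 - 2) =
  d * (k%:R * d) - d * q * (z + a) ^+ 2 - d * (k%:R * d ^+ 3 * q / 3) - 2 * d by ring.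
by lra.
Qed.

Lemma value_minorant_shift k rho (s : R) :
  let z := k%:R * d ^+ 2 / 2 - rho in
  value_minorant d a k (rho - s) =
  value_minorant d a k rho - 2 * q * (z + a) * s - q * s ^+ 2.
Proof. by rewrite /value_minorant -/q; field. Qed.

Lemma value_minorantS k rho :
  let z := k%:R * d ^+ 2 / 2 - rho in
  value_minorant d a k.+1 rho <=
  value_minorant d a k rho + (d - q * (z + a) * d ^+ 2 - q / 3 * d ^+ 3).
Proof.
rewrite /value_minorant -/q -natr1 -subr_ge0.
set X := (X in 0 <= X); have -> : X = q * (d ^+ 2 / 2) ^+ 2 by rewrite /X; field.
by rewrite mulr_ge0 ?sqr_ge0// ltW.
Qed.

Lemma value_leD k m rho : value m rho <= value (k + m) rho.
Proof. by elim: k => // k IH; rewrite addSn (le_trans IH)// value_leS. Qed.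

Lemma gain_ge f rho u x : nondecreasing_fun f -> u <= 1 ->
  selectable rho u -> x <= step rho u -> 1 + f x <= gain f rho u.
Proof.
move=> ndf u1 sel xs; rewrite /gain /gain_on sel le_max lerD2l.
by rewrite (ndf _ _ xs) orbT.
Qed.

(** Inside the window of width [d] below the last value the gain is bounded by selecting, elsewhere
    by rejecting. *)
Lemma value_lower_decreasing k rho : 0 <= rho <= 1 ->
  value_minorant d a k rho <= value k rho.
Proof.
elim: k rho => [|k IH] rho /andP[r0 r1].
  have [rd|rd] := leP rho d; first exact: value_minorant_le0.
  rewrite /value_minorant -/q !mul0r /=.
  have : 0 <= q * (0 - rho + a) ^+ 2 by rewrite mulr_ge0 ?sqr_ge0// ltW.
  by lra.
have [rd|rd] := leP rho d.
  by apply: le_trans (value_minorant_le0 _ rd) _; exact: value_ge0.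
pose z := k%:R * d ^+ 2 / 2 - rho.
apply: le_trans (value_minorantS k rho) _; rewrite -/z.
have -> : d - q * (z + a) * d ^+ 2 - q / 3 * d ^+ 3 =
    quad_prim 1 (2 * q * (z + a)) (- q) rho rho
    - quad_prim 1 (2 * q * (z + a)) (- q) rho (rho - d).
  by rewrite /quad_prim; field.
apply: Rintegral_ge_piece; [lra|by move: d0; lra|lra|exact: integrable_gain_value|].
move=> u /andP[u0 u1]; rewrite /piece; case: ifPn => [/andP[h1 h2]|_].
  apply: (@le_trans _ _ (1 + value_minorant d a k (rho - (rho - u)))).
    by rewrite value_minorant_shift -/z /quad; lra.
  rewrite (_ : rho - (rho - u) = u); last by ring.
  apply: (@le_trans _ _ (1 + value k u)); first by rewrite lerD2l IH// u0.
  apply: gain_ge => //; first exact: value_nd.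
    by rewrite /selectable h2 orbT.
  by rewrite /step; case: ifP => ?; lra.
rewrite addr0; apply: le_trans (gain_on_ge _ _ _ u).
by apply: IH; rewrite r0.
Qed.

(** Here [rho] is the room of the increasing piece alone, whose last value is [1 - rho]. Once
    [rho <= d] this piece is abandoned: any of its remaining steps are wasted, and the decreasing
    piece still has [m] steps and room 1. *)
Lemma value_lower_increasing k m rho : 0 <= rho <= 1 ->
  value_minorant d a k rho + value m 1 <= value (k + m) (1 + rho).
Proof.
elim: k rho => [|k IH] rho /andP[r0 r1].
  have w0 : value_minorant d a 0 rho <= 0.
    have [rd|rd] := leP rho d; first exact: value_minorant_le0.
    rewrite /value_minorant -/q !mul0r /=.
    have : 0 <= q * (0 - rho + a) ^+ 2 by rewrite mulr_ge0 ?sqr_ge0// ltW.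
    by lra.
  have : value m 1 <= value m (1 + rho) by apply: value_nd; lra.
  by rewrite add0n; lra.
have [rd|rd] := leP rho d.
  have := value_minorant_le0 k.+1 rd.
  have : value m 1 <= value m (1 + rho) by apply: value_nd; lra.
  have := value_leD k.+1 m (1 + rho).
  by lra.
pose z := k%:R * d ^+ 2 / 2 - rho.
have := value_minorantS k rho; rewrite -/z => wS.
apply: le_trans (lerD wS (lexx (value m 1))) _; rewrite addrAC.
have -> : d - q * (z + a) * d ^+ 2 - q / 3 * d ^+ 3 =
    quad_prim 1 (- (2 * q * (z + a))) (- q) (1 - rho) (1 - rho + d)
    - quad_prim 1 (- (2 * q * (z + a))) (- q) (1 - rho) (1 - rho).
  by rewrite /quad_prim; field.
apply: Rintegral_ge_piece; [lra|by move: d0; lra|lra|exact: integrable_gain_value|].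
move=> u /andP[u0 u1]; rewrite /piece; case: ifPn => [/andP[h1 h2]|_].
  apply: (@le_trans _ _ (1 + (value_minorant d a k (rho - (u - (1 - rho))) + value m 1))).
    by rewrite value_minorant_shift -/z /quad; lra.
  apply: (@le_trans _ _ (1 + value (k + m) (1 + (rho - (u - (1 - rho)))))).
    by rewrite lerD2l; apply: IH; lra.
  apply: gain_ge => //; first exact: value_nd.
    by rewrite /selectable; apply/orP; left; lra.
  by rewrite /step; case: ifP => ?; lra.
rewrite addr0; apply: le_trans (gain_on_ge _ _ _ u).
by apply: IH; rewrite r0.
Qed.

End value_lower_bound.

(** * Choice of window and penalty for the lower bound *)

Section value_lower_asymptotics.
Context {R : realType}.

(** Each piece gets [m] steps and room 1. The width [d = 2 / r ^+ 2] makes the expected expense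
    [m * d ^+ 2 / 2] equal to this room, so that [z = 0]. With [a = r^-1] the losses [q * a ^+ 2]
    and [m * d ^+ 3 * q / 3] have the same order: they are [r / 4] and [r / 3], in sum [7 / 12 * r]
    for each piece. *)
Lemma value_lower_even (m : nat) (r : R) : 0 < r -> r ^+ 4 = (m + m)%:R ->
  2 * r ^+ 2 - 7 / 6 * r - 4 <= value (m + m) 2.
Proof.
move=> r0 r4.
have r0' : r != 0 by rewrite gt_eqF.
have d0 : 0 < 2 / r ^+ 2 by rewrite divr_gt0// exprn_gt0.
have a0 : 0 < r^-1 by rewrite invr_gt0.
have h01 : (0 <= 1 :> R) && (1 <= 1 :> R) by rewrite ler01 lexx.
have h1 := value_lower_decreasing d0 a0 m h01.
have h2 := value_lower_increasing d0 a0 m m h01.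
have wE : value_minorant (2 / r ^+ 2) r^-1 m 1 = r ^+ 2 - 7 / 12 * r - 2.
  have mE : m%:R = r ^+ 4 / 2 by rewrite r4 natrD; field.
  by rewrite /value_minorant mE; field.
rewrite wE in h1 h2.
rewrite (_ : 1 + 1 = 2 :> R) in h2; last by ring.
by lra.
Qed.

Lemma value_lower_powR (n : nat) : (1 <= n)%N ->
  2 * (n%:R `^ (1 / 2)) - 4 * ((pi / 6) `^ (1 / 2)) * (n%:R `^ (1 / 4)) - 10
    < value n 3 :> R.
Proof.
move=> n1; rewrite value_ge2; last by lra.
set s := n%:R `^ (1 / 2); set r := n%:R `^ (1 / 4); set p := (pi / 6) `^ (1 / 2).
have s0 : 0 <= s by exact: powR_ge0.
have r0 : 0 <= r by exact: powR_ge0.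
have ss : s ^+ 2 = n%:R.
  by rewrite -powR_mulrn// -powRrM (_ : 1 / 2 * 2%:R = 1) ?powRr1//; field.
have pi2 := pi_ge2 R.
(* A quarter of [7 / 6], to be compared with the factor [4 * p]. *)
have p7 : 7 / 24 <= p.
  have p0 : 0 <= p by exact: powR_ge0.
  rewrite leNgt; apply/negP => hp.
  have : p ^+ 2 = pi / 6.
    rewrite -powR_mulrn// -powRrM (_ : 1 / 2 * 2%:R = 1) ?powRr1//; last by field.
    by lra.
  have : p ^+ 2 <= (7 / 24) ^+ 2 by rewrite lerXn2r// ?nnegrE; lra.
  by lra.
have pr : 7 / 24 * r <= p * r by rewrite ler_wpM2r.
(* An odd [n] gives up one variable. This costs at most 2, by [s <= t ^+ 2 + 1], so that with the 4
   of the even case the constant 10 leaves a margin for strictness. *)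
pose m := n./2.
have mn : (m + m <= n)%N by rewrite addnn -[leqRHS]odd_double_half leq_addl.
have nm : (n <= (m + m).+1)%N.
  by rewrite addnn -[leqLHS]odd_double_half -add1n leq_add2r leq_b1.
have vv : value (m + m) 2 <= value n 2 :> R.
  by rewrite -(subnK mn) value_leD.
have [m0|m0] := posnP m.
  have s1 : s <= 1.
    rewrite leNgt; apply/negP => hs.
    have : 1 < s ^+ 2 by rewrite exprn_egt1.
    by rewrite ss ltNge (ler_nat _ n 1) (leq_trans nm) ?m0.
  have := @value_ge0 R n 2; have : 0 <= p * r by rewrite mulr_ge0// ?powR_ge0.
  by lra.
pose t : R := (m + m)%:R `^ (1 / 4).
have mm0 : 0 < (m + m)%:R :> R by rewrite ltr0n addn_gt0 m0.
have t0 : 0 < t by rewrite powR_gt0.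
have t4 : t ^+ 4 = (m + m)%:R.
  by rewrite -powR_mulrn ?ltW// -powRrM (_ : 1 / 4 * 4%:R = 1) ?powRr1 ?ltW//; field.
have tr : t <= r.
  by apply: ge0_ler_powR; rewrite ?nnegrE ?ler_nat//; lra.
have st : s <= t ^+ 2 + 1.
  rewrite -(@ler_pXn2r _ 2%N) ?nnegrE//; last by have := sqr_ge0 t; lra.
  have : s ^+ 2 <= t ^+ 4 + 1 by rewrite ss t4 natr1 ler_nat.
  have := sqr_ge0 t.
  have -> : (t ^+ 2 + 1) ^+ 2 = t ^+ 4 + 2 * t ^+ 2 + 1 by ring.
  by lra.
have := value_lower_even t0 t4.
by lra.
Qed.

End value_lower_asymptotics.

(** * Uniform law of [F (X i)] and its independence of the past *)

Section uniform_transform.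
Context (R : realType) (d : measure_display) (T : measurableType d)
  (P : probability T R) (X : nat -> {RV P >-> R}) (F : R -> R).
Hypotheses (hind : mutually_independent X)
  (hcdf : forall i : nat, has_cdf (X i) F) (hcont : continuous F).
Notation mu := (@lebesgue_measure R).

Lemma cdf_nd : nondecreasing_fun F.
Proof.
by move=> x y xy; rewrite -lee_fin -!(hcdf 0); exact: cdf_nondecreasing.
Qed.

Lemma cdf_bounds x : 0 <= F x <= 1.
Proof. by rewrite -!lee_fin -(hcdf 0) cdf_ge0 cdf_le1. Qed.

(** Restricted to interior levels because [F] may approach 0 and 1 without attaining them. *)
Lemma cdf_surjective r : 0 < r < 1 -> exists x, F x = r.
Proof.
move=> /andP[r0 r1].
have FE : cdf (X 0%N) = EFin \o F by apply/funext => x; rewrite hcdf.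
have [a Far] : exists a, F a < r.
  have := cvg_cdfNy0 (X 0%N); rewrite FE => /fine_cvg /= /cvgrPdist_lt /(_ r r0).
  case=> M [_ /(_ (M - 1))]; rewrite sub0r normrN => h.
  exists (M - 1); apply: le_lt_trans (ler_norm _) _; apply: h; lra.
have [b Fbr] : exists b, r < F b.
  have h1 : 0 < 1 - r by lra.
  have := cvg_cdfy1 (X 0%N); rewrite FE => /fine_cvg /= /cvgrPdist_lt /(_ _ h1).
  case=> M [_ /(_ (M + 1))] h.
  exists (M + 1); have := ler_norm (1 - F (M + 1)).
  have : `|1 - F (M + 1)| < 1 - r by apply: h; lra.
  by lra.
have ab : a <= b.
  rewrite leNgt; apply/negP => ba; have := cdf_nd (ltW ba); lra.
have [||c _ Fc] := @IVT _ F a b r ab.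
- exact: continuous_subspaceT.
- rewrite ge_min le_max; apply/andP; split; apply/orP; [left|right]; lra.
by exists c.
Qed.

Definition unif k (w : T) := F (X k w).

Lemma unif01 k w : 0 <= unif k w <= 1.
Proof. exact: cdf_bounds. Qed.

Lemma measurable_unif k : measurable_fun setT (unif k).
Proof.
apply: measurableT_comp => //.
by apply: nondecreasing_measurable => //; exact: cdf_nd.
Qed.

Definition unif_mfun k : {mfun T >-> measurableTypeR R} :=
  HB.pack (unif k : T -> measurableTypeR R)
    (isMeasurableFun.Build _ _ T (measurableTypeR R) (unif k) (measurable_unif k)).

Lemma prob_unif_le k r : 0 <= r < 1 -> P [set w | unif k w <= r] = r%:E.
Proof.
move=> /andP[r0 r1].
have mU : measurable [set w | unif k w <= r].
  have := @measurable_fun_ler _ _ _ setT _ _ (measurable_unif k) (measurable_cst r).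
  by move=> /(_ measurableT [set true] I); rewrite setTI.
have XE x : P [set w | X k w <= x] = (F x)%:E.
  rewrite -(hcdf k); apply: (congr1 P).
  by apply/seteqP; split => w /=; rewrite in_itv.
have mX x : measurable [set w | X k w <= x].
  have := @measurable_fun_ler _ _ _ setT _ _ (measurable_funP (X k)) (measurable_cst x).
  by move=> /(_ measurableT [set true] I); rewrite setTI.
apply/eqP; rewrite eq_le; apply/andP; split.
  apply/lee_addgt0Pr => e e0.
  (* [F] may be flat at level [r], so the event is enclosed in one for a level slightly above [r];
     the second term keeps this level below 1, where it is attained. *)
  pose r' := Num.min (r + e) ((r + 1) / 2).
  have r'01 : 0 < r' < 1.
    by rewrite /r' lt_min gt_min; apply/andP; split; [apply/andP; split; lra|apply/orP; right; lra].
  have r'r : r < r' by rewrite /r' lt_min; apply/andP; split; lra.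
  have [x Fx] := cdf_surjective r'01.
  apply: (@le_trans _ _ (P [set w | X k w <= x])).
    apply: le_measure; rewrite ?inE// => w /=; rewrite /unif => Fw.
    rewrite leNgt; apply/negP => xw; have := cdf_nd (ltW xw); lra.
  by rewrite XE Fx -EFinD lee_fin /r' ge_min lexx.
have [->|rn0] := eqVneq r 0; first exact: measure_ge0.
have [|x Fx] := @cdf_surjective r; first by rewrite lt_neqAle eq_sym rn0 r0.
apply: (@le_trans _ _ (P [set w | X k w <= x])); first by rewrite XE Fx.
apply: le_measure; rewrite ?inE// => w /= xw.
by rewrite /unif -Fx; exact: cdf_nd.
Qed.

Lemma distribution_unif k (A : set R) : measurable A -> A `<=` `[0, 1] ->
  distribution P (unif_mfun k) A = mu A.
Proof.
move=> mA A01.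
rewrite -[in RHS](setIidl A01).
have m01 : measurable (`[0, 1]%classic : set (measurableTypeR R)) by [].
pose m1 : {measure set (measurableTypeR R) -> \bar R} :=
  distribution P (unif_mfun k).
pose m2 : {measure set (measurableTypeR R) -> \bar R} := mrestr mu m01.
suff h : m1 A = m2 A by exact: h.
have mu12 := @measure_unique _ R (measurableTypeR R) (@RGenOInfty.G R)
  (fun n => `](- n%:R)%R, +oo[%classic) _ _ _ _ m1 m2 _ _ A.
apply: mu12 => //.
- exact: RGenOInfty.measurableE.
- move=> _ _ [x ->] [y ->]; exists (Num.max x y).
  apply/seteqP; split => z /=; rewrite !in_itv/= !andbT gt_max; last by move/andP.
  by case=> -> ->.
- by move=> n; exists (- n%:R).
- apply/seteqP; split => // x _; exists (Num.truncn `|x|).+1 => //=.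
  rewrite in_itv/= andbT ltrNl; apply: le_lt_trans (truncnS_gt _).
  by rewrite -normrN ler_norm.
- move=> _ [r ->].
  change (P (unif k @^-1` `]r, +oo[%classic)
    = mu (`]r, +oo[%classic `&` `[0, 1]%classic)).
  have [r0|r0] := ltP r 0.
    rewrite (_ : _ @^-1` _ = setT); last first.
      apply/seteqP; split => // w _ /=; rewrite in_itv/= andbT.
      by have := unif01 k w; lra.
    rewrite probability_setT (_ : _ `&` _ = `[0, 1]%classic); last first.
      apply/seteqP; split => x /=; rewrite !in_itv/=; first by case.
      by move=> /andP[? ?]; split; lra.
    by rewrite lebesgue_measure_itv/= lte_fin ltr01 -EFinB subr0.
  have [r1|r1] := ltP r 1; last first.
    rewrite (_ : _ @^-1` _ = set0); last first.
      apply/seteqP; split => // w /=; rewrite in_itv/= andbT.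
      by have := unif01 k w; lra.
    rewrite (_ : _ `&` _ = set0) ?measure0//.
    apply/seteqP; split => x //=; rewrite !in_itv/= => -[].
    by move=> h1 /andP[h2 h3]; lra.
  have -> : unif k @^-1` `]r, +oo[ = ~` [set w | unif k w <= r].
    apply/seteqP; split => w /=; rewrite in_itv/= andbT; first by lra.
    by move/negP; lra.
  rewrite probability_setC; last first.
    have := @measurable_fun_ler _ _ _ setT _ _ (measurable_unif k) (measurable_cst r).
    by move=> /(_ measurableT [set true] I); rewrite setTI.
  rewrite prob_unif_le ?r0// (_ : _ `&` _ = `]r, 1]%classic).
    by rewrite lebesgue_measure_itv/= lte_fin r1 -EFinB.
  apply/seteqP; split => x /=; rewrite !in_itv/=.
    by case=> h1 /andP[h2 h3]; apply/andP; split; lra.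
  by move=> /andP[h1 h2]; split; lra.
- by move=> n; apply: le_lt_trans (probability_le1 _ _) _ => //; rewrite ltry.
Qed.

(** What is known before time [k]: [natural_filtration X i] is [past X i.+1], and [past X 0] is
    trivial. *)
Definition past k : set (set T) := g_sigma_preimage (fun j : 'I_k => (X j : T -> R)).

Let cylinders k : set (set T) := [set A | exists2 B : nat -> set R,
  (forall j, measurable (B j)) &
  A = \bigcap_(j in [set` [fset i in iota 0 k]%fset]) X j @^-1` B j].

Let cylinderE k (B : nat -> set R) w :
  (\bigcap_(j in [set` [fset i in iota 0 k]%fset]) X j @^-1` B j) w <->
  forall j, (j < k)%N -> B j (X j w).
Proof.
split => h j.
  by move=> jk; apply: h; rewrite /= !inE mem_iota.
by rewrite /= !inE mem_iota/=; exact: h.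
Qed.

Let past_cylinders k : past k `<=` <<s cylinders k>>.
Proof.
apply: smallest_sub; first exact: smallest_sigma_algebra.
apply: (big_ind (fun Z => Z `<=` <<s cylinders k>>)).
- by move=> ? [].
- by move=> Y Z hY hZ A [/hY|/hZ].
move=> j _ _ [B mB <-]; apply: sub_sigma_algebra.
exists (fun i : nat => if i == j :> nat then B else setT); first by move=> i; case: ifP.
apply/seteqP; split => w.
  by move=> [_ h]; apply/cylinderE => i ik; case: eqP => // ->.
by move/cylinderE => /(_ j (ltn_ord j)); rewrite eqxx => h; split.
Qed.

Let measurable_preimage k (B : set R) : measurable B -> measurable (X k @^-1` B).
Proof. by move=> mB; rewrite -[_ @^-1` _]setTI; exact: measurable_funP. Qed.

Let measurable_cylinders k : cylinders k `<=` measurable.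
Proof.
move=> _ [B mB ->]; apply: fin_bigcap_measurable => // j _.
exact: measurable_preimage.
Qed.

Lemma past_measurable k A : past k A -> measurable A.
Proof.
move=> /past_cylinders; apply: smallest_sub; first exact: sigma_algebra_measurable.
exact: measurable_cylinders.
Qed.

(** Both sides are finite measures in [A]. They agree on [cylinders k] by the assumed independence,
    and this family is stable under intersection and generates a sigma-algebra containing
    [past k]. *)
Lemma past_indep k A C : past k A -> measurable C ->
  P (A `&` X k @^-1` C) = (P A * P (X k @^-1` C))%E.
Proof.
move=> pA mC; have mXC := measurable_preimage k mC.
pose c : {nonneg R} := NngNum (fine_ge0 (measure_ge0 P (X k @^-1` C))).
have cE : (c%:num%:E = P (X k @^-1` C))%E by rewrite /c/= fineK// fin_num_measure.
pose m1 : {measure set T -> \bar R} := mrestr P mXC.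
pose m2 : {measure set T -> \bar R} := mscale c P.
have m2E B : m2 B = (P B * P (X k @^-1` C))%E by rewrite muleC -cE.
rewrite -m2E; change (m1 A = m2 A).
apply: (@g_sigma_algebra_measure_unique _ R T (cylinders k) _ (fun=> setT)).
- exact: measurable_cylinders.
- move=> _; exists (fun=> setT) => //.
  by apply/seteqP; split => w // _; apply/cylinderE.
- by apply/seteqP; split => // w _; exists 0%N.
- move=> _ _ [B mB ->] [B' mB' ->]; exists (fun j => B j `&` B' j).
    by move=> j; exact: measurableI.
  apply/seteqP; split => w.
    by move=> [/cylinderE h1 /cylinderE h2]; apply/cylinderE => j jk; split; [exact: h1|exact: h2].
  by move/cylinderE => h; split; apply/cylinderE => j /h[].
- move=> _ [B mB ->]; rewrite m2E.
  change (P (\bigcap_(j in [set` [fset i in iota 0 k]%fset]) X j @^-1` B j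
    `&` X k @^-1` C) = (P (\bigcap_(j in [set` [fset i in iota 0 k]%fset])
    X j @^-1` B j) * P (X k @^-1` C))%E).
  pose B' j := if j == k then C else B j.
  have mB' j : measurable (B' j) by rewrite /B'; case: ifP.
  have kJ : k \notin [fset i in iota 0 k]%fset by rewrite !inE mem_iota/= ltnn.
  have JE j : j \in [fset i in iota 0 k]%fset -> B' j = B j.
    by move=> jJ; rewrite /B'; case: eqP => // jk; move: kJ; rewrite -{1}jk jJ.
  have := hind (k |` [fset i in iota 0 k])%fset mB'.
  have B'k : B' k = C by rewrite /B' eqxx.
  rewrite big_fsetU1//= B'k.
  rewrite (eq_big_seq (fun j => P (X j @^-1` B j))); last by move=> j /JE ->.
  rewrite -hind// muleC => <-; congr (P _).
  apply/seteqP; split => w.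
    move=> [h hC] j /=; rewrite in_fset1U => /orP[/eqP ->|jJ].
      by rewrite /B' eqxx.
    by rewrite (JE _ jJ); exact: h.
  move=> h; split.
    by move=> j jJ; rewrite -(JE _ jJ); apply: h; rewrite /= in_fset1U; apply/orP; right.
  by have := h k; rewrite /B' eqxx; apply; rewrite /= in_fset1U eqxx.
- move=> _; change (P (setT `&` X k @^-1` C) < +oo)%E.
  by rewrite setTI -cE ltry.
- exact: past_cylinders.
Qed.

Lemma past_eq_unif k (A : set T) (C : set R) : past k A -> measurable C ->
  P (A `&` unif k @^-1` C) = (P A * P (unif k @^-1` C))%E.
Proof.
move=> pA mC.
have mF : measurable_fun setT F by apply: nondecreasing_measurable => //; exact: cdf_nd.
have mFC : measurable (F @^-1` C) by rewrite -[_ @^-1` _]setTI; exact: mF.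
exact: (past_indep pA mFC).
Qed.

Lemma integral_unif k (h : measurableTypeR R -> \bar R) :
  measurable_fun setT h -> (forall u, 0 <= h u)%E ->
  (\int[distribution P (unif_mfun k)]_u h u = \int[mu]_(u in `[0%R, 1%R]) h u)%E.
Proof.
move=> mh h0.
transitivity (\int[distribution P (unif_mfun k)]_(u in `[0%R, 1%R]) h u)%E; last first.
  by apply: eq_measure_integral => A mA A01; exact: distribution_unif.
rewrite ge0_integral_pushforward//.
rewrite ge0_integral_pushforward//; last exact: measurable_funTS.
rewrite (_ : _ @^-1` `[0%R, 1%R]%classic = setT); last first.
  by apply/seteqP; split => // w _; exact: (unif01 k w).
by rewrite preimage_setT.
Qed.

(** By independence the pair of [Y] and [unif k] has the product law, so Tonelli integrates the new
    uniform variable with the past frozen. *)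
Lemma integral_past k (Y : T -> R) (g : measurableTypeR R * measurableTypeR R -> \bar R) :
  (forall B : set R, measurable B -> past k (Y @^-1` B)) ->
  measurable_fun setT g -> (forall z, 0 <= g z)%E ->
  (\int[P]_w g (Y w, unif k w) =
   \int[P]_w \int[mu]_(u in `[0%R, 1%R]) g (Y w, u))%E.
Proof.
move=> pY mg g0.
have mY : measurable_fun setT (Y : T -> measurableTypeR R).
  by move=> _ B mB; rewrite setTI; apply: (@past_measurable k); exact: pY.
pose Ym : {mfun T >-> measurableTypeR R} :=
  HB.pack (Y : T -> measurableTypeR R)
    (isMeasurableFun.Build _ _ T (measurableTypeR R) Y mY).
have mYU : measurable_fun setT (fun w => (Y w, unif k w) :
    (measurableTypeR R * measurableTypeR R)%type).
  by apply: measurable_fun_pair => //; exact: (measurable_unif k).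
pose YU : {mfun T >-> (measurableTypeR R * measurableTypeR R)%type} :=
  HB.pack (fun w => (Y w, unif k w) : (measurableTypeR R * measurableTypeR R)%type)
    (isMeasurableFun.Build _ _ T (measurableTypeR R * measurableTypeR R)%type _ mYU).
pose m1 := distribution P Ym.
pose m2 := distribution P (unif_mfun k).
have law A : measurable A -> (m1 \x m2)%E A = distribution P YU A.
  apply: product_measure_unique => {}A B mA mB.
  exact: (past_eq_unif (pY _ mA) mB).
transitivity (\int[distribution P YU]_z g z)%E.
  by rewrite ge0_integral_pushforward.
transitivity (\int[m1 \x m2]_z g z)%E.
  by apply: eq_measure_integral => A mA _; exact/esym/law.
rewrite fubini_tonelli1//.
rewrite ge0_integral_pushforward//.
- rewrite preimage_setT; apply: eq_integral => w _ /=.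
  rewrite /fubini_F integral_unif//.
  by apply: (measurableT_comp mg); exact: measurable_fun_pair.
- exact: measurable_fun_fubini_tonelli_F.
- by move=> y _; exact: integral_ge0.
Qed.

End uniform_transform.

(** * Admissible runs and unimodal sequences *)

Section runs.
Context {R : realType}.
Implicit Types (rho u : R) (s : seq R).

(** [sel] is the weak rule when an arbitrary policy is analysed and the strict rule when the optimal
    one is built. *)
Fixpoint admissible (sel : R -> R -> bool) rho s :=
  if s is u :: s' then sel rho u && admissible sel (step rho u) s' else true.

Lemma admissible_cat sel rho s1 s2 : admissible sel rho (s1 ++ s2) =
  admissible sel rho s1 && admissible sel (foldl step rho s1) s2.
Proof. by elim: s1 rho => //= u s1 IH rho; rewrite IH andbA. Qed.

Definition in01 u := 0 <= u <= 1.

Lemma admissible_decreasing s rho u : in01 u -> all in01 s -> u <= rho ->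
  path >=%O u s -> admissible selectable rho s.
Proof.
elim: s rho u => //= v s IH rho u /andP[u0 u1] /andP[v01 s01] ur /andP[vu p].
have vu' : v <= u by [].
rewrite {1}/selectable (le_trans vu' ur) orbT/=.
apply: (IH _ v) => //; have /andP[v0 v1] := v01.
by rewrite /step; case: ifP => _; lra.
Qed.

(** Before the peak the next value is at least the current [u], so the room [2 - u] admits it as an
    extension; from the peak on the values stay below the room. *)
Lemma admissible_unimodal s t rho : all in01 s -> 2 - head 2 s <= rho ->
  (t < size s)%N -> sorted <=%O (take t.+1 s) -> sorted >=%O (drop t s) ->
  admissible selectable rho s.
Proof.
elim: s t rho => //= u s IH [|t] rho /andP[u01 s01] ur ts.
  move=> _ p; have /andP[u0 u1] := u01.
  rewrite {1}/selectable ur/=; apply: (@admissible_decreasing _ _ u) => //.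
  by rewrite /step ur; lra.
move=> pu pd; rewrite {1}/selectable ur/= /step ur.
apply: (IH t) => //; last exact: path_sorted pu.
case: s ts pu {pd IH s01} => //= v s _ /andP[uv _].
have uv' : u <= v by [].
lra.
Qed.

Lemma strictly_admissible_decreasing s rho : all in01 s -> rho <= 1 ->
  admissible strictly_selectable rho s -> path >%O rho s.
Proof.
elim: s rho => //= u s IH rho /andP[/andP[u0 u1] s01] r1 /andP[sel adm].
have ur : u < rho.
  by move: sel; rewrite /strictly_selectable lt_min => /orP[|/andP[]]; lra.
have su : step rho u = u by rewrite /step ifF//; apply/negbTE; rewrite -ltNge; lra.
by rewrite ur/=; rewrite su in adm; apply: IH => //; lra.
Qed.

(** The peak is the value before the first descent: after it the room is at most 1, and then only
    smaller values are strictly selectable. *)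
Lemma strictly_admissible_increasing s u : in01 u -> all in01 s ->
  admissible strictly_selectable (2 - u) s ->
  exists2 t, (t <= size s)%N &
    path <%O u (take t s) /\ path >%O (last u (take t s)) (drop t s).
Proof.
elim: s u => [|v s IH] u /= u01 => [_ _|/andP[v01 s01] /andP[sel adm]].
  by exists 0%N.
have /andP[u0 u1] := u01; have /andP[v0 v1] := v01.
have [uv|vu] := ltP u v.
  have sv : step (2 - u) v = 2 - v by rewrite /step ifT//; lra.
  rewrite sv in adm; have [t ts [p1 p2]] := IH v v01 s01 adm.
  by exists t.+1 => //=; rewrite uv.
have vu' : v < u.
  by move: sel; rewrite /strictly_selectable lt_min => /orP[|/andP[]]; lra.
have sv : step (2 - u) v = v by rewrite /step ifF//; apply/negbTE; rewrite -ltNge; lra.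
exists 0%N => //=; split=> //; rewrite vu'/=; rewrite sv in adm.
exact: strictly_admissible_decreasing.
Qed.

Lemma strictly_admissible_unimodal s : all in01 s -> s != [::] ->
  admissible strictly_selectable 3 s ->
  exists2 t, (t < size s)%N & sorted <%O (take t.+1 s) /\ sorted >%O (drop t s).
Proof.
case: s => //= u s /andP[u01 s01] _ /andP[_].
have /andP[u0 u1] := u01.
have -> : step 3 u = 2 - u by rewrite /step ifT//; lra.
move=> /(strictly_admissible_increasing u01 s01)[t ts [p1 p2]].
exists t; first by rewrite ltnS.
split; first exact: p1.
case: t ts p1 p2 => [|t] ts p1 p2; first by move: p2; rewrite take0 !drop0.
have lE : last u (take t.+1 s) = nth u s t.
  by rewrite (last_nth u) size_takel//= nth_take.
by rewrite /= (drop_nth u ts) -lE.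
Qed.

End runs.

(** * Expected number of selections of an adapted decision process *)

Section decision_processes.
Context (R : realType) (d : measure_display) (T : measurableType d)
  (P : probability T R) (X : nat -> {RV P >-> R}) (F : R -> R).
Hypotheses (hind : mutually_independent X)
  (hcdf : forall i : nat, has_cdf (X i) F) (hcont : continuous F).
Notation unif := (unif X F).
Implicit Types (D : nat -> T -> bool) (k n : nat).

Fixpoint room D k w : R :=
  if k is k'.+1 then
    if D k' w then step (room D k' w) (unif k' w) else room D k' w
  else 3.

(** The decision at time [k] may use [X k] itself, hence the index [k.+1]. *)
Definition adapted D := forall k, past X k.+1 [set w | D k w].

Notation past_space k := (g_sigma_algebraType
  (\big[setU/set0]_(i < k) preimage_set_system setT (X i : T -> R) measurable)).

Lemma past_leS k : past X k `<=` past X k.+1.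
Proof.
rewrite /past /g_sigma_preimage big_ord_recr/=.
by apply: sub_sigma_algebra2 => A; left.
Qed.

Lemma past_measurable_funS k (f : T -> R) :
  measurable_fun setT (f : past_space k -> R) ->
  measurable_fun setT (f : past_space k.+1 -> R).
Proof.
by move=> mf mT B mB; rewrite setTI; apply: past_leS; rewrite -[_ @^-1` _]setTI; exact: mf.
Qed.

Lemma past_measurable_unif k : measurable_fun setT (unif k : past_space k.+1 -> R).
Proof.
have mF : measurable_fun setT F by apply: nondecreasing_measurable => //; exact: cdf_nd hcdf.
move=> mT B mB; rewrite setTI; apply: sub_sigma_algebra.
rewrite big_ord_recr/=; right.
exists (F @^-1` B); first by rewrite -[_ @^-1` _]setTI; exact: mF.
by rewrite setTI.
Qed.

Lemma measurable_room_past D k : adapted D ->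
  measurable_fun setT (room D k : past_space k -> R).
Proof.
move=> aD; elim: k => [|k IH] /=; first exact: measurable_cst.
have mr := past_measurable_funS IH.
apply: measurable_fun_ifT => //.
  by apply: (measurable_fun_bool true) => //; rewrite setTI; exact: aD.
by apply: measurable_step => //; exact: past_measurable_unif.
Qed.

Lemma past_room D k : adapted D ->
  forall B : set R, measurable B -> past X k (room D k @^-1` B).
Proof.
move=> aD B mB; have : past X k ([set: T] `&` room D k @^-1` B).
  exact: (measurable_room_past aD measurableT mB).
by rewrite setTI.
Qed.

Lemma measurable_room D k : adapted D -> measurable_fun setT (room D k).
Proof.
move=> aD _ B mB; rewrite setTI; apply: (@past_measurable _ _ _ _ X k).
exact: past_room.
Qed.

Lemma measurable_value_room D m k : adapted D ->
  measurable_fun setT (fun w => value m (room D k w)).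
Proof.
move=> aD; apply: measurableT_comp; last exact: measurable_room.
by apply: nondecreasing_measurable => //; exact: value_nd.
Qed.

(** The room before time [k] depends on the past only, so averaging over the new variable is one
    step of the recursion for [value]. *)
Lemma integral_gain_room D m k : adapted D ->
  (\int[P]_w (gain (value m) (room D k w) (unif k w))%:E =
   \int[P]_w (value m.+1 (room D k w))%:E)%E.
Proof.
move=> aD.
rewrite (integral_past hind hcdf hcont (g := fun z => (gain (value m) z.1 z.2)%:E)
  (past_room aD)).
- apply: eq_integral => w _ /=; rewrite fineK//.
  exact: integrable_fin_num (integrable_gain_value _ _).
- apply/measurable_EFinP; apply: measurable_gain => //; exact: value_nd.
- by move=> z; rewrite lee_fin; apply: le_trans (gain_on_ge _ _ _ _); exact: value_ge0.
Qed.

Lemma integral_strict_gain_room D m k : adapted D ->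
  (\int[P]_w (strict_gain (value m) (room D k w) (unif k w))%:E =
   \int[P]_w (value m.+1 (room D k w))%:E)%E.
Proof.
move=> aD.
rewrite (integral_past hind hcdf hcont (g := fun z => (strict_gain (value m) z.1 z.2)%:E)
  (past_room aD)).
- by apply: eq_integral => w _ /=; rewrite value_strict_gain.
- apply/measurable_EFinP; apply: measurable_strict_gain => //; exact: value_nd.
- by move=> z; rewrite lee_fin; apply: le_trans (gain_on_ge _ _ _ _); exact: value_ge0.
Qed.

Definition nb_selected D k w : R := \sum_(j < k) (D j w)%:R.

Lemma measurable_decision D k : adapted D ->
  measurable_fun setT (fun w => (D k w)%:R : R).
Proof.
move=> aD; rewrite (_ : (fun w => _) = \1_[set w | D k w]).
  by apply: measurable_indic; apply: (@past_measurable _ _ _ _ X k.+1); exact: aD.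
by apply/funext => w; rewrite indicE; case: (boolP (D k w)) => h;
  [rewrite mem_set|rewrite memNset//; exact/negP].
Qed.

Lemma measurable_nb_selected D k : adapted D ->
  measurable_fun setT (nb_selected D k).
Proof. by move=> aD; apply: measurable_sum => j; exact: measurable_decision. Qed.

Lemma nb_selected_ge0 D k w : 0 <= nb_selected D k w.
Proof. exact: sumr_ge0. Qed.

Let potential D n k := (\int[P]_w (nb_selected D k w + value (n - k) (room D k w))%:E)%E.

Let potential0 D n : potential D n 0 = (value n 3)%:E.
Proof.
rewrite /potential /=; under eq_integral do rewrite /nb_selected big_ord0 add0r subn0.
rewrite integral_cst//.
by rewrite -[RHS]mule1; congr (_ * _)%E; exact: probability_setT.
Qed.

Let potentialn D n : potential D n n = (\int[P]_w (nb_selected D n w)%:E)%E.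
Proof.
by rewrite /potential; apply: eq_integral => w _; rewrite subnn addr0.
Qed.

Let integral_potential D n k (f : T -> R) : adapted D -> measurable_fun setT f ->
  (forall w, 0 <= f w) ->
  (\int[P]_w (nb_selected D k w + f w)%:E =
   \int[P]_w (nb_selected D k w)%:E + \int[P]_w (f w)%:E)%E.
Proof.
move=> aD mf f0; under eq_integral do rewrite EFinD.
rewrite ge0_integralD//.
- by move=> w _; rewrite lee_fin nb_selected_ge0.
- by apply/measurable_EFinP; exact: measurable_nb_selected.
- by move=> w _; rewrite lee_fin.
- exact/measurable_EFinP.
Qed.

Let potentialS_integrand D n k w : (k < n)%N ->
  nb_selected D k.+1 w + value (n - k.+1) (room D k.+1 w) =
  nb_selected D k w + ((D k w)%:R + value (n - k.+1) (room D k.+1 w)).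
Proof. by rewrite /nb_selected big_ord_recr/= addrA. Qed.

Let measurable_increment D m k : adapted D ->
  measurable_fun setT (fun w => (D k w)%:R + value m (room D k.+1 w)).
Proof.
move=> aD; apply: measurable_funD; first exact: measurable_decision.
exact: measurable_value_room.
Qed.

(** [potential] does not increase with time: pointwise, the decision together with the value left
    after it is at most the [gain], whose mean is the value with one more step to go. *)
Lemma integral_nb_selected_le D n : adapted D ->
  (forall k w, (k < n)%N -> D k w -> selectable (room D k w) (unif k w)) ->
  (\int[P]_w (nb_selected D n w)%:E <= (value n 3)%:E)%E.
Proof.
move=> aD selD; rewrite -(potential0 D) -potentialn.
suff H k : (k <= n)%N -> (potential D n k <= potential D n 0)%E by exact: H.
elim: k => // k IH kn; apply: le_trans (IH (ltnW kn)) => {IH}.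
rewrite /potential; under eq_integral do rewrite potentialS_integrand//.
have nk : (n - k = (n - k.+1).+1)%N by rewrite subnSK.
rewrite !integral_potential//; first last.
- by move=> w; exact: value_ge0.
- exact: measurable_value_room.
- by move=> w; rewrite addr_ge0// value_ge0.
- exact: measurable_increment.
rewrite nk leeD2l// -integral_gain_room//.
apply: ge0_le_integral => //.
- by move=> w _; rewrite lee_fin addr_ge0// value_ge0.
- by apply/measurable_EFinP; exact: measurable_increment.
- apply/measurable_EFinP; apply: measurable_gain; [exact: measurable_room|exact: measurable_unif|exact: value_nd].
move=> w _; rewrite lee_fin /=; case: ifPn => Dk; last by rewrite add0r gain_on_ge.
by rewrite /gain /gain_on selD// le_max lexx orbT.
Qed.

(** [m] counts the variables still to come after the one being decided. *)
Definition optimal_decision m (rho u : R) :=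
  strictly_selectable rho u && (value m rho <= 1 + value m (step rho u)).

Lemma measurable_optimal_decision d' (T' : measurableType d') m (r v : T' -> R) :
  measurable_fun setT r -> measurable_fun setT v ->
  measurable_fun setT (fun x => optimal_decision m (r x) (v x)).
Proof.
move=> mr mv.
have mvalue : measurable_fun setT (value m : R -> R).
  by apply: nondecreasing_measurable => //; exact: value_nd.
apply: measurable_and; first exact: measurable_strictly_selectable.
apply: measurable_fun_ler; first exact: measurableT_comp.
apply: measurable_funD => //; apply: measurableT_comp => //.
exact: measurable_step.
Qed.

Lemma strict_gain_optimal m (rho u : R) : strict_gain (value m) rho u =
  (optimal_decision m rho u)%:R +
  value m (if optimal_decision m rho u then step rho u else rho).
Proof.
rewrite /strict_gain /gain_on /optimal_decision; case: ifP => //= _; last by rewrite add0r.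
by case: leP => h; rewrite ?add0r.
Qed.

Lemma integral_nb_selected_optimal D n : adapted D ->
  (forall k w, (k < n)%N -> D k w = optimal_decision (n - k.+1) (room D k w) (unif k w)) ->
  (\int[P]_w (nb_selected D n w)%:E = (value n 3)%:E)%E.
Proof.
move=> aD selD; rewrite -(potential0 D) -potentialn.
suff H k : (k <= n)%N -> (potential D n k = potential D n 0)%E by exact: H.
elim: k => // k IH kn; rewrite -(IH (ltnW kn)) => {IH}.
rewrite /potential; under eq_integral do rewrite potentialS_integrand//.
have nk : (n - k = (n - k.+1).+1)%N by rewrite subnSK.
rewrite !integral_potential//; first last.
- by move=> w; exact: value_ge0.
- exact: measurable_value_room.
- by move=> w; rewrite addr_ge0// value_ge0.
- exact: measurable_increment.
rewrite nk -integral_strict_gain_room//; congr (_ + _)%E.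
by apply: eq_integral => w _; rewrite strict_gain_optimal /= selD.
Qed.

End decision_processes.

(** * Translation between policies and decision processes *)

Section policies.
Context (R : realType) (d : measure_display) (T : measurableType d)
  (P : probability T R) (X : nat -> {RV P >-> R}) (F : R -> R).
Hypotheses (hind : mutually_independent X)
  (hcdf : forall i : nat, has_cdf (X i) F) (hcont : continuous F).
Notation unif := (unif X F).
Notation room := (room X F).
Notation nb_selected := (nb_selected R).
Notation past_space k := (g_sigma_algebraType
  (\big[setU/set0]_(i < k) preimage_set_system setT (X i : T -> R) measurable)).
Implicit Types (D : nat -> T -> bool) (tau : T -> seq nat) (k n : nat).

Definition selection D n w := [seq j <- iota 0 n | D j w].

Lemma selectionS D n w :
  selection D n.+1 w = if D n w then rcons (selection D n w) n else selection D n w.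
Proof. by rewrite /selection -addn1 iotaD cats1 filter_rcons. Qed.

Lemma room_foldl D n w :
  room D n w = foldl step 3 [seq unif j w | j <- selection D n w].
Proof.
elim: n => // n IH; rewrite selectionS /=; case: ifP => _ //.
by rewrite map_rcons foldl_rcons IH.
Qed.

Lemma nb_selected_size D n w : nb_selected D n w = (size (selection D n w))%:R :> R.
Proof.
elim: n => [|n IH]; first by rewrite /nb_selected big_ord0.
rewrite /nb_selected big_ord_recr/= -/(nb_selected D n w) IH selectionS.
by case: ifP => _; rewrite ?addr0// size_rcons natr1.
Qed.

Lemma admissible_selectionP sel D n w :
  admissible sel 3 [seq unif j w | j <- selection D n w] <->
  forall k, (k < n)%N -> D k w -> sel (room D k w) (unif k w).
Proof.
elim: n => [|n IH]; first by split.
rewrite selectionS; split.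
  move=> h; have adm : admissible sel 3 [seq unif j w | j <- selection D n w].
    by move: h; case: ifP => // _; rewrite map_rcons -cats1 admissible_cat => /andP[].
  move=> k; rewrite ltnS leq_eqVlt => /orP[/eqP -> Dn|kn]; last exact: (IH.1 adm).
  move: h; rewrite Dn map_rcons -cats1 admissible_cat -room_foldl => /andP[_] /=.
  by rewrite andbT.
move=> h; have adm := IH.2 (fun k kn => h k (ltnW kn)).
case: ifP => // Dn; rewrite map_rcons -cats1 admissible_cat adm -room_foldl/= andbT.
exact: h.
Qed.

Lemma selection_mem D n w j : (j \in selection D n w) = D j w && (j < n)%N.
Proof. by rewrite mem_filter mem_iota. Qed.

Lemma selection_sorted D n w : sorted ltn (selection D n w).
Proof. by apply: sorted_filter; [exact: ltn_trans|exact: iota_ltn_sorted]. Qed.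

Lemma selection_in_policy tau n w : sorted ltn (tau w) -> all (ltn^~ n) (tau w) ->
  selection (fun k w => k \in tau w) n w = tau w.
Proof.
move=> st an; apply: (irr_sorted_eq ltn_trans ltnn) => //.
  exact: selection_sorted.
move=> j; rewrite selection_mem andb_idr// => jt.
by move/allP: an => /(_ j jt).
Qed.

Lemma all_in01_unif (s : seq nat) w : all in01 [seq unif j w | j <- s].
Proof. by apply/allP => _ /mapP[j _ ->]; exact: (unif01 hcdf). Qed.

(** The time [k] is selected when, for some [j], the [j]-th selected index is at most [k] but not at
    most [k - 1]; the latter event is empty for [k = 0]. *)
Lemma adapted_policy tau n : feasible X n tau -> adapted X (fun k w => k \in tau w).
Proof.
case=> _ stop _ k.
pose A i j := [set w | exists2 m, onth (tau w) j = Some m & (m <= i)%N].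
have pA i j : past X i.+1 (A i j) by exact: stop.
pose B j := if k is k'.+1 then A k' j else set0.
have pB j : past X k.+1 (B j).
  rewrite /B; case: (k) => [|k']; last by apply: past_leS; exact: pA.
  exact: sigma_algebra0.
rewrite (_ : [set w | _] = \bigcup_j (A k j `\` B j)).
  apply: sigma_algebra_bigcup => j.
  exact: (@measurableD _ (past_space k.+1) _ _ (pA k j) (pB j)).
apply/seteqP; split => w /=.
  move/onthP => [j jk]; exists j => //; split; first by exists k.
  rewrite /B; case: (k) jk => [_ []|k' jk [m]].
  by rewrite jk => -[<-]; rewrite ltnn.
move=> [j _ [[m jm mk] nB]]; apply/onthP; exists j; rewrite jm; congr Some.
apply/eqP; rewrite eqn_leq mk/= leqNgt; apply/negP => km; apply: nB.
rewrite /B; case: (k) km => // k' km; by exists m.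
Qed.

Lemma map_cdf_sorted (r : rel R) (s : seq R) :
  {homo F : x y / r x y} -> sorted r s -> sorted r (map F s).
Proof. by move=> h; exact: homo_sorted. Qed.

Lemma selectable_policy tau n k w : feasible X n tau -> (k < n)%N -> k \in tau w ->
  selectable (room (fun k w => k \in tau w) k w) (unif k w).
Proof.
case=> st _ uni kn kt; have [sw aw] := st w.
apply: (admissible_selectionP selectable (fun k w => k \in tau w) n w).1 => //.
rewrite selection_in_policy//.
have [t ts [s1 s2]] := uni w.
have -> : [seq unif j w | j <- tau w] = map F [seq X j w | j <- tau w].
  by rewrite -map_comp.
have Fle : {homo F : x y / x <= y} := cdf_nd hcdf.
apply: (@admissible_unimodal _ _ t).
- by rewrite -map_comp; exact: all_in01_unif.
- case: (tau w) => /= [|j s]; first by lra.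
  by have := cdf_bounds hcdf (X j w); lra.
- by rewrite size_map.
- by rewrite -map_take; apply: map_cdf_sorted s1.
- by rewrite -map_drop; apply: map_cdf_sorted s2 => x y /Fle.
Qed.

Lemma expectation_policy_le tau n : feasible X n tau ->
  ('E_P[selected_length R tau] <= (value n 3)%:E)%E.
Proof.
move=> ft; pose D k w := k \in tau w.
have -> : selected_length R tau = nb_selected D n.
  apply/funext => w; case: ft => st _ _; have [sw aw] := st w.
  by rewrite nb_selected_size selection_in_policy.
rewrite unlock; apply: (integral_nb_selected_le hind hcdf hcont).
  exact: adapted_policy ft.
by move=> k w kn kt; exact: selectable_policy ft kn kt.
Qed.

(** Decisions depend on rooms and rooms on earlier decisions; inlining the decision in the recursion
    for the room breaks this circle. *)
Fixpoint optimal_room n k w : R :=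
  if k is k'.+1 then
    let r := optimal_room n k' w in
    if optimal_decision (n - k) r (unif k' w) then step r (unif k' w) else r
  else 3.

Definition optimal_select n k w :=
  optimal_decision (n - k.+1) (optimal_room n k w) (unif k w).

Lemma room_optimal n k w : room (optimal_select n) k w = optimal_room n k w.
Proof. by elim: k => //= k IH; rewrite IH /optimal_select. Qed.

Lemma past_measurable_optimal_room n k :
  measurable_fun setT (optimal_room n k : past_space k -> R).
Proof.
elim: k => [|k IH]; first exact: measurable_cst.
have mr := past_measurable_funS IH.
have mu := past_measurable_unif hcdf (k := k).
apply: (@measurable_fun_ifT _ _ _ _ _ _
  (fun w : past_space k.+1 => optimal_decision (n - k.+1) (optimal_room n k w) (unif k w))) => //.
  exact: measurable_optimal_decision.
exact: measurable_step.
Qed.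

Lemma adapted_optimal n : adapted X (optimal_select n).
Proof.
move=> k.
have mD : measurable_fun setT (optimal_select n k : past_space k.+1 -> bool).
  apply: measurable_optimal_decision; last exact: past_measurable_unif.
  by apply: past_measurable_funS; exact: past_measurable_optimal_room.
have : past X k.+1 ([set: T] `&` optimal_select n k @^-1` [set true]).
  exact: (mD measurableT [set true] I).
by rewrite setTI.
Qed.

Definition optimal_policy n (w : T) := selection (optimal_select n) n w.

(** The [j]-th index, counted from 0, is at most [i] exactly when more than [j] selections fall
    among the first [minn n i.+1] variables. *)
Lemma stopping_time_selection D n j : adapted X D ->
  stopping_time (natural_filtration X) (fun w => onth (selection D n w) j).
Proof.
move=> aD i; pose k := minn n i.+1.
rewrite (_ : [set w | _] = [set w | (j < size (selection D k w))%N]).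
  have mN l : measurable_fun setT (nb_selected D l : past_space l -> R).
    elim: l => [|l IH].
      rewrite (_ : nb_selected D 0 = cst 0); first exact: measurable_cst.
      by apply/funext => w; rewrite /nb_selected big_ord0.
    rewrite (_ : nb_selected D l.+1 = fun w => nb_selected D l w + (if D l w then 1 else 0)).
      apply: measurable_funD; first exact: past_measurable_funS.
      apply: measurable_fun_ifT => //.
      by apply: (measurable_fun_bool true) => //; rewrite setTI; exact: aD.
    by apply/funext => w; rewrite /nb_selected big_ord_recr/=; case: (D l w).
  have past_le l m : (l <= m)%N -> past X l `<=` past X m.
    move=> /subnKC <-; elim: (m - l)%N => [|a IH]; first by rewrite addn0.
    by rewrite addnS => A /IH; exact: past_leS.
  apply: (past_le k); first exact: geq_minr.
  have mj : measurable_fun setT (fun w : past_space k => (j%:R : R) < nb_selected D k w).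
    by apply: measurable_fun_ltr => //; exact: mN.
  rewrite (_ : [set w | _] = [set: T] `&` (fun w => (j%:R : R) < nb_selected D k w) @^-1` [set true]).
    exact: (mj measurableT [set true] I).
  by apply/seteqP; split => w /=; rewrite nb_selected_size ltr_nat => // -[].
have kn : (k <= n)%N by exact: geq_minl.
have sE w : selection D n w = selection D k w ++ [seq a <- iota k (n - k) | D a w].
  by rewrite /selection -filter_cat -iotaD subnKC.
apply/seteqP; split => w /=; rewrite sE onth_cat.
  move=> [m + mi]; case: ltnP => // _ jm.
  have : m \in [seq a <- iota k (n - k) | D a w] by apply/onthP; eexists; exact: jm.
  rewrite mem_filter mem_iota subnKC// => /and3P[_ km mn].
  by move: km; rewrite /k geq_min leqNgt mn ltnNge mi.
move=> jk; rewrite jk; move: (jk); rewrite -onthTE.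
case E : (onth _ _) => [m|]// _; exists m => //.
have : m \in selection D k w by apply/onthP; exists j.
by rewrite selection_mem => /andP[_]; rewrite /k ltn_min => /andP[_].
Qed.

Lemma optimal_room_nil n w k : selection (optimal_select n) k w = [::] ->
  optimal_room n k w = 3.
Proof. by rewrite -room_optimal room_foldl => ->. Qed.

(** With nothing selected before the last variable the room is still 3, and selecting it is worth 1
    against 0. Feasibility demands this, since the empty sequence is not unimodal. *)
Lemma optimal_policy_neq0 n w : (1 <= n)%N -> optimal_policy n w != [::].
Proof.
case: n => // n _; rewrite /optimal_policy selectionS.
case: ifPn => [_|]; first by case: (selection _ _ _).
apply: contra => /eqP /optimal_room_nil r3.
rewrite /optimal_select /optimal_decision r3 subnn /strictly_selectable /=.
have /andP[u0 u1] := unif01 (P := P) hcdf n w.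
by apply/andP; split; [apply/orP; left|]; lra.
Qed.

Lemma feasible_optimal n : (1 <= n)%N -> feasible X n (optimal_policy n).
Proof.
move=> n1; split.
- move=> w; split; first exact: selection_sorted.
  by apply/allP => j; rewrite selection_mem => /andP[].
- by move=> j; apply: stopping_time_selection; exact: adapted_optimal.
- move=> w; set s := optimal_policy n w.
  have sn : s != [::] by exact: optimal_policy_neq0.
  have [] := @strictly_admissible_unimodal _ [seq unif j w | j <- s].
  + exact: all_in01_unif.
  + by case: (s) sn.
  + apply/admissible_selectionP => k kn.
    by rewrite room_optimal => /andP[].
  move=> t; rewrite size_map => ts [s1 s2]; exists t; first by rewrite size_map.
  have XF i j : unif i w < unif j w -> X i w <= X j w.
    move=> h; rewrite leNgt; apply/negP => /ltW /(cdf_nd hcdf).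
    by rewrite leNgt => /negP; apply.
  rewrite -!map_take -!map_drop !sorted_map in s1 s2 *; split.
    by apply: sub_sorted s1 => i j; exact: XF.
  by apply: sub_sorted s2 => i j; exact: XF.
Qed.

Lemma expectation_optimal_policy n :
  'E_P[selected_length R (optimal_policy n)]%E = (value n 3)%:E.
Proof.
have -> : selected_length R (optimal_policy n) = nb_selected (optimal_select n) n.
  by apply/funext => w; rewrite nb_selected_size.
rewrite unlock; apply: (integral_nb_selected_optimal hind hcdf hcont).
  exact: adapted_optimal.
by move=> k w kn; rewrite room_optimal.
Qed.

Lemma sup_expectation n : (1 <= n)%N ->
  ereal_sup [set 'E_P[selected_length R tau]%E | tau in feasible X n] = (value n 3)%:E.
Proof.
move=> n1; apply/eqP; rewrite eq_le; apply/andP; split.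
  by apply: ge_ereal_sup => _ [tau ft <-]; exact: expectation_policy_le.
apply: ereal_sup_ubound; exists (optimal_policy n); first exact: feasible_optimal.
exact: expectation_optimal_policy.
Qed.

Lemma optimal_expectation n tau : (1 <= n)%N -> optimal X n tau ->
  'E_P[selected_length R tau]%E = (value n 3)%:E.
Proof. by move=> n1 [_ ->]; exact: sup_expectation. Qed.

End policies.

(** * Asymptotic equivalence *)

Section expectation_asymptotics.
Context {R : realType}.
Implicit Types n : nat.

Lemma value_upper_powR n : (1 <= n)%N -> value n 3 < 2 * n%:R `^ (1 / 2) :> R.
Proof. by move=> n1; rewrite div1r powR12_sqrt//; exact: value_upper_sqrt. Qed.

Lemma value_equiv (f : nat -> R) : (forall n, (1 <= n)%N -> f n = value n 3) ->
  (f : nat -> R^o) ~_\oo (fun n => 2 * n%:R `^ (1 / 2) : R^o).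
Proof.
move=> fE; apply/eqaddoP => e e0.
pose c : R := 4 * ((pi / 6) `^ (1 / 2)).
have c0 : 0 <= c by rewrite mulr_ge0// powR_ge0.
pose K := Num.max 1 ((c + 10) / (2 * e)).
have K1 : 1 <= K by rewrite le_max lexx.
have Ke : c + 10 <= K * (2 * e).
  by rewrite -ler_pdivrMr ?mulr_gt0// le_max lexx orbT.
exists (Num.truncn (K ^+ 4)).+1 => //= n /= Kn.
have n1 : (1 <= n)%N by apply: leq_trans Kn.
have Kn' : K ^+ 4 <= n%:R.
  by apply: ltW; apply: lt_le_trans (truncnS_gt _) _; rewrite ler_nat.
rewrite fctE fE//; have := value_upper_powR n1; have := @value_lower_powR R n n1.
rewrite -/c; set r := _ `^ (1 / 4); set s := _ `^ (1 / 2) => lo up.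
have r0 : 0 <= r by exact: powR_ge0.
have s0 : 0 <= s by exact: powR_ge0.
have sE : s = r ^+ 2 by rewrite /r -powR_mulrn ?powR_ge0// -powRrM; congr (_ `^ _); field.
have r4 : r ^+ 4 = n%:R.
  by rewrite -powR_mulrn// -powRrM (_ : 1 / 4 * 4%:R = 1) ?powRr1//; field.
have Kr : K <= r by rewrite -(@ler_pXn2r _ 4%N) ?nnegrE// ?r4//; lra.
change (`|value n 3 - 2 * s| <= e * `|2 * s|).
rewrite ltr0_norm; last by lra.
rewrite ger0_norm; last by rewrite mulr_ge0.
have h1 : (c + 10) * r <= K * (2 * e) * r by rewrite ler_wpM2r.
have h2 : K * (2 * e * r) <= r * (2 * e * r).
  by rewrite ler_wpM2r// mulr_ge0// ltW// mulr_gt0.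
have h3 : 10 <= 10 * r by lra.
by rewrite sE in lo up *; lra.
Qed.

End expectation_asymptotics.

Theorem theorem1 (R : realType) (d : measure_display) (T : measurableType d)
    (P : probability T R) (X : nat -> {RV P >-> R}) (F : R -> R)
    (hind : mutually_independent X)
    (hcdf : forall i : nat, has_cdf (X i) F)
    (hcont : continuous F) :
  [/\ (forall n : nat, (1 <= n)%N ->
         exists tau : T -> seq nat, optimal X n tau),
      (forall (n : nat) (tau : T -> seq nat),
         (1 <= n)%N -> optimal X n tau ->
         ('E_P[selected_length R tau] < (2 * (n%:R `^ (1 / 2)))%:E)%E),
      (exists C : R, forall (n : nat) (tau : T -> seq nat),
         (1 <= n)%N -> optimal X n tau ->
         ((2 * (n%:R `^ (1 / 2))
            - 4 * ((pi / 6) `^ (1 / 2)) * (n%:R `^ (1 / 4)) - C)%:E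
          < 'E_P[selected_length R tau])%E)
    & (forall tau : nat -> T -> seq nat,
         (forall n : nat, (1 <= n)%N -> optimal X n (tau n)) ->
         (fun n : nat => fine 'E_P[selected_length R (tau n)]%E : R^o)
           ~_\oo (fun n : nat => 2 * (n%:R `^ (1 / 2)) : R^o))].
Proof.
split.
- move=> n n1; exists (optimal_policy X F n); split.
    exact: (feasible_optimal hcdf).
  by rewrite (sup_expectation hind hcdf hcont)// (expectation_optimal_policy hind hcdf hcont).
- move=> n tau n1 opt.
  by rewrite (optimal_expectation hind hcdf hcont n1 opt) lte_fin value_upper_powR.
- exists 10 => n tau n1 opt.
  by rewrite (optimal_expectation hind hcdf hcont n1 opt) lte_fin value_lower_powR.
- move=> tau opt; apply: value_equiv => n n1.
  by rewrite (optimal_expectation hind hcdf hcont n1 (opt n n1)).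
Qed.
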